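(* Let $k\ge 2$ be an integer and let $\lambda_1\ge \dots\ge \lambda_k>0$ be fixed real numbers. Set $\Lambda=\lambda_1+\dots+\lambda_k$ and $\lambda_i^*=\Lambda-\lambda_i$. For each $n$, let $G=G_1\cup\dots\cup G_k$ be the randomly edge-colored graph on $[n]$ described in the context, and let $\widetilde{\mathcal C}(u)$ be the CA-component of $u\in[n]$. Suppose that $\lambda_k^*=1>\lambda_{k-1}^*$. Then $$\sup_{n\ge1}\ \mathbb P\Big(\max_{u\in[n]}|\widetilde{\mathcal C}(u)|\ge M\Big)\xrightarrow[M\to\infty]{}0.$$
   Context: $[m]=\{1,\dots,m\}$. $G(n,p)$ is the Erdős–Rényi random graph on vertex set $[n]$ in which each edge is present independently with probability $p$. For each $n$, $G_1,\dots,G_k$ are independent random graphs on the same vertex set $[n]$, with $G_i$ distributed as $G(n,\lambda_i/n)$; the edges of $G_i$ are said to have color $i$. $G=G_1\cup\dots\cup G_k$, and for $i\in[k]$, $G^i=\bigcup_{j\in[k]\setminus\{i\}}G_j$. Two vertices $u,v\in[n]$ are CA-connected if they are connected in each of the graphs $G^1,\dots,G^k$. This is an equivalence relation on $[n]$, whose classes are the CA-components; $\widetilde{\mathcal C}(u)$ is the class of $u$ and $|\widetilde{\mathcal C}(u)|$ is its number of vertices. *)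

(* Defs.v *)
From HB Require Import structures.
From mathcomp Require Import all_boot all_order all_algebra.
From mathcomp Require Import all_classical all_reals all_analysis.

Set Implicit Arguments.
Unset Strict Implicit.
Unset Printing Implicit Defensive.

Import Order.TTheory GRing.Theory Num.Theory.
Import numFieldNormedType.Exports.

Local Open Scope ring_scope.

(* The vertex set [n] is represented by 'I_n. *)
Definition edge (n : nat) := {e : {set 'I_n} | #|e| == 2%N}.

(* A simple graph on [n] is given by its set of edges. *)
Definition graph (n : nat) := {set edge n}.

Definition adj (n : nat) (g : graph n) : rel 'I_n :=
  fun u v => [exists e in g, val e == [set u; v]%SET].

Definition connected_in (n : nat) (g : graph n) : rel 'I_n := connect (adj g).

(* The graph G^i, in which the edges of color i are ignored; an edge carrying
   several colors is kept as soon as one of them differs from i. *)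
Definition avoid_color (n k : nat) (G : 'I_k -> graph n) (i : 'I_k) : graph n :=
  (\bigcup_(j < k | j != i) G j)%SET.

Definition CA_connected (n k : nat) (G : 'I_k -> graph n) : rel 'I_n :=
  fun u v => [forall i : 'I_k, connected_in (avoid_color G i) u v].

Definition CA_component (n k : nat) (G : 'I_k -> graph n) (u : 'I_n) :
    {set 'I_n} :=
  [set v | CA_connected G u v]%SET.

Definition max_CA_component (n k : nat) (G : 'I_k -> graph n) : nat :=
  (\max_(u < n) #|CA_component G u|)%N.

Lemma connected_in_sym (n : nat) (g : graph n) : symmetric (connected_in g).
Proof.
by apply/sym_connect_sym => u v; apply: eq_existsb => e; rewrite finset.setUC.
Qed.

Lemma CA_connected_equiv (n k : nat) (G : 'I_k -> graph n) :
  equivalence_rel (CA_connected G).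
Proof.
move=> u v w; split; first by apply/forallP => i; exact: connect0.
move=> /forallP uv; apply: eq_forallb => i.
exact: (same_connect (@connected_in_sym _ _) (uv i)).
Qed.

(* The probability, under G(n, p), that the graph is exactly g. *)
Definition gnp_mass (R : realType) (n : nat) (p : R) (g : graph n) : R :=
  \prod_(e : edge n) (if e \in g then p else 1 - p).

Section RandomGraphs.
Context (R : realType) (d : measure_display) (T : measurableType d).
Variable P : probability T R.

Definition is_Gnp (n : nat) (p : R) (X : T -> graph n) : Prop :=
  (forall A : set (graph n), measurable (X @^-1` A)%classic) /\
  (forall g : graph n, P (X @^-1` [set g])%classic = (gnp_mass p g)%:E).

Definition independent_graphs (n k : nat) (X : 'I_k -> T -> graph n) : Prop :=
  forall A : 'I_k -> set (graph n),
    P [set w | forall i, A i (X i w)]%classic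
    = (\prod_(i < k) P (X i @^-1` A i)%classic)%E.

Definition colored_random_graph (n k : nat) (lambda : 'I_k -> R)
    (X : 'I_k -> T -> graph n) : Prop :=
  (forall i, is_Gnp (lambda i / n%:R) (X i)) /\ independent_graphs X.

End RandomGraphs.

Definition lambda_star (R : realType) (k : nat) (lambda : 'I_k -> R)
    (i : 'I_k) : R :=
  \sum_(j < k) lambda j - lambda i.

(* Main.v *)
Require Import Defs.
From HB Require Import structures.
From mathcomp Require Import all_boot all_order all_algebra.
From mathcomp Require Import all_classical all_reals all_analysis.
From mathcomp Require Import ring lra.
Import Order.TTheory GRing.Theory Num.Theory.
Import numFieldNormedType.Exports.
Local Open Scope ring_scope.

(** Let [L] be the last color. Call a pair of vertices bad if its two vertices
    are connected in every [G^i] with [i <> L] but not in [G_L], the graph of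
    the edges of color [L]. A CA-component containing [u] lies in the union of
    the vertices forming a bad pair with [u] and of the intersection of the
    clusters of [u] in [G_L] and in [G^L] ([CA_class_le]). The number of bad
    pairs is tight, and with high probability all these intersections have at
    most five vertices.

    Bad pairs. All [G^i] with [i <> L] are subcritical: their mean degrees are
    at most some [mu < 1]. Take a simple path from [u] to [v] in one of them.
    If [(u, v)] is bad, some edge of the path does not have color [L]. Either
    this edge carries two other colors, or it carries a single color [j] and is
    absent from [G^j], in which [u] and [v] are nevertheless connected; then
    two vertices of the path are joined in [G^j] without using the edges of the
    path ([bypass], [bad_pair_defect]). A given path of length [l] is present
    with probability at most [(mu / n) ^ l] and there are at most [n ^ (l + 1)]
    of them. Up to a polynomial in [l], each of the two coincidences costs one
    more factor [O(1 / n)]: an edge carries two colors with probability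
    [O(n ^ (-2))], and two given vertices are joined off the path, independently
    of it, with probability [O(1 / n)]. Hence the expected number of bad pairs
    is bounded ([expect_defective_pairs]).

    Intersections. The graphs [G_L] and [G^L] are independent, [G_L] is
    subcritical and [G^L] is critical. Generating functions of cluster sizes
    are compared with those of branching processes by exploring clusters vertex
    by vertex ([explored_le], [explored_ge]). In the critical graph a cluster
    has at least [s] vertices with probability [O(s ^ (-1/2))], so some cluster
    has at least [s] vertices with probability [O(n s ^ (-3/2))]
    ([critical_max_tail]); this vanishes for [s = n ^ (3/4)]. The cluster of
    [u] in the subcritical graph meets a given set of at most [s] vertices
    containing [u] in six vertices or more with probability
    [O((s / n) ^ 5) = O(n ^ (-5/4))] ([subcritical_cluster_meets]), which can be
    summed over [u].

    Together, a CA-component of size at least [M] exists with probability at most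
    [C / (M - 5) + C n ^ (-1/8)] ([CA_class_tail]). This is small, uniformly in
    large [n], when [M] is large; the remaining [n] are bounded, and so are the
    components on [n] vertices.

    The computations take place on a finite product space: a field of
    independent identically distributed values indexed by sets of vertices,
    where the value at [{x, y}] is the set of colors of the edge [xy]. *)

Set Implicit Arguments.
Unset Strict Implicit.
Unset Printing Implicit Defensive.

(** * The law of independent identically distributed coordinates *)

Section Expectation.
Context {R : realFieldType} {B : finType}.
Implicit Types m : B -> R.

Definition is_pmf m := (forall b, 0 <= m b) /\ \sum_b m b = 1.

Definition pr m (Q : pred B) : R := \sum_(b | Q b) m b.

Definition expect (T : finType) m (f : {ffun T -> B} -> R) : R :=
  \sum_(w : {ffun T -> B}) (\prod_t m (w t)) * f w.

Lemma pr_ge0 m Q : is_pmf m -> 0 <= pr m Q.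
Proof. by case=> m0 _; apply: sumr_ge0. Qed.

Lemma sum_pmf_indic m (Q : pred B) : \sum_b m b * (Q b)%:R = pr m Q.
Proof.
rewrite /pr [RHS]big_mkcond; apply: eq_bigr => b _.
by case: (Q b); rewrite ?mulr1 ?mulr0.
Qed.

Lemma sum_pmf_if m (Q : pred B) (x y : R) : is_pmf m ->
  \sum_b m b * (if Q b then x else y) = pr m Q * x + (1 - pr m Q) * y.
Proof.
move=> [_ m1]; rewrite (bigID Q) /=.
rewrite (eq_bigr (fun b => m b * x)); last by move=> b ->.
rewrite [X in _ + X](eq_bigr (fun b => m b * y)); last first.
  by move=> b /negbTE ->.
rewrite -!mulr_suml.
have -> : \sum_(b | ~~ Q b) m b = 1 - pr m Q.
  by rewrite -m1 [in RHS](bigID Q) /= /pr; ring.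
by rewrite -/(pr m Q); ring.
Qed.

Lemma bool_le_sum (I : finType) (b : bool) (f : I -> R) :
  (forall i, 0 <= f i) -> (b -> exists i, 1 <= f i) -> b%:R <= \sum_i f i.
Proof.
move=> f0; case: b => [/(_ isT)[i fi]|_]; last by apply: sumr_ge0.
by rewrite (bigD1 i) //=; apply: ler_wpDr fi; apply: sumr_ge0.
Qed.

Lemma le_pr m (Q Q' : pred B) : is_pmf m ->
  (forall b, Q b -> Q' b) -> pr m Q <= pr m Q'.
Proof.
move=> [m0 _] QQ'; rewrite -!sum_pmf_indic; apply: ler_sum => b _.
by rewrite ler_wpM2l // ler_nat; case: (Q b) (QQ' b) => // ->.
Qed.

Lemma pr_exists_le (I : finType) m (Q : I -> pred B) : is_pmf m ->
  pr m (fun b => [exists i, Q i b]) <= \sum_i pr m (Q i).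
Proof.
move=> [m0 _]; rewrite -sum_pmf_indic.
under [leRHS]eq_bigr do rewrite -sum_pmf_indic.
rewrite exchange_big; apply: ler_sum => b _; rewrite -mulr_sumr ler_wpM2l //.
apply: bool_le_sum => // /existsP[i Qi]; exists i.
by rewrite Qi.
Qed.

Lemma pr_andl m (x : bool) (Q : pred B) :
  pr m (fun b => x && Q b) = if x then pr m Q else 0.
Proof. by case: x => //; rewrite /pr big_pred0. Qed.

Section Basics.
Context (T : finType) (m : B -> R).
Hypothesis m_pmf : is_pmf m.
Local Notation E := (@expect T m).

Lemma mass_ge0 (w : {ffun T -> B}) : 0 <= \prod_t m (w t).
Proof. by apply: prodr_ge0 => t _; case: m_pmf. Qed.

Lemma eq_expect f g : f =1 g -> E f = E g.
Proof. by move=> fg; apply: eq_bigr => w _; rewrite fg. Qed.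

Lemma le_expect f g : (forall w, f w <= g w) -> E f <= E g.
Proof. by move=> fg; apply: ler_sum => w _; rewrite ler_wpM2l ?mass_ge0. Qed.

Lemma expectZ c f : E (fun w => c * f w) = c * E f.
Proof. by rewrite /expect mulr_sumr; apply: eq_bigr => w _; ring. Qed.

Lemma expect_sum (I : Type) (r : seq I) (P : pred I) f :
  E (fun w => \sum_(i <- r | P i) f i w) = \sum_(i <- r | P i) E (f i).
Proof.
rewrite /expect exchange_big; apply: eq_bigr => w _.
by rewrite mulr_sumr.
Qed.

Lemma expectD f g : E (fun w => f w + g w) = E f + E g.
Proof. by rewrite /expect -big_split; apply: eq_bigr => w _; rewrite mulrDr. Qed.

(** Reading each coordinate at most once, the factors are independent: the sum
    over all fields factorizes over the coordinates, and those that are not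
    read contribute the total mass [1]. *)
Lemma expect_prod (I : finType) (A : {pred I}) (h : I -> T)
    (phi : I -> B -> R) :
  {in A &, injective h} ->
  E (fun w => \prod_(i in A) phi i (w (h i)))
  = \prod_(i in A) \sum_b m b * phi i b.
Proof.
move=> inj_h.
have fiber t (F : I -> R) : (forall i, i \in A -> h i = t ->
    \prod_(j in A | h j == t) F j = F i).
  move=> i Ai hi; rewrite (big_pred1 i) // => j /=.
  apply/andP/eqP => [[Aj /eqP hj]|-> //]; first by apply: inj_h; rewrite ?hi.
  by rewrite hi.
transitivity (E (fun w => \prod_t \prod_(i in A | h i == t) phi i (w t))).
  apply: eq_expect => w; rewrite (partition_big h predT) //=.
  by apply: eq_bigr => t _; apply: eq_bigr => i /andP[_ /eqP ->].
transitivity (\sum_(w : {ffun T -> B})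
    \prod_t (m (w t) * \prod_(i in A | h i == t) phi i (w t))).
  by apply: eq_bigr => w _; rewrite -big_split.
rewrite -(bigA_distr_bigA
  (fun t b => m b * \prod_(i in A | h i == t) phi i b)).
rewrite [RHS](partition_big h predT) //=; apply: eq_bigr => t _.
have [i /andP[Ai /eqP hi]|none] := pickP [pred i | (i \in A) && (h i == t)].
  rewrite (fiber t (fun i => \sum_b m b * phi i b) i) //.
  by apply: eq_bigr => b _; rewrite (fiber t (fun i => phi i b) i).
rewrite [RHS]big_pred0 //; case: m_pmf => _ m1; rewrite -[RHS]m1.
by apply: eq_bigr => b _; rewrite big_pred0 ?mulr1.
Qed.

Lemma expect_cst c : E (fun=> c) = c.
Proof.
rewrite /expect -mulr_suml -(bigA_distr_bigA (fun _ b => m b)) big1 ?mul1r //.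
by move=> t _; case: m_pmf.
Qed.

(** Fubini's theorem in resampled form. Exchanging part of the data of two
    independent copies is a measure-preserving involution of pairs, so a field
    assembled from two independent copies has the law of a single one. *)
Lemma expect_resample (theta : T -> B -> B -> B) f :
  (forall t b c, m (theta t b c) * m (theta t c b) = m b * m c) ->
  (forall t b c, theta t (theta t b c) (theta t c b) = b) ->
  E f = E (fun w => E (fun w' => f [ffun t => theta t (w t) (w' t)])).
Proof.
move=> mass_theta thetaK.
pose mix (w w' : {ffun T -> B}) := [ffun t => theta t (w t) (w' t)].
pose mass (w : {ffun T -> B}) := \prod_t m (w t).
transitivity (\sum_(p : {ffun T -> B} * {ffun T -> B})
    mass p.1 * mass p.2 * f p.1).
  rewrite -(pair_big predT predT (fun w w' => mass w * mass w' * f w)) /=.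
  apply: eq_bigr => w _; transitivity (mass w * E (fun=> f w)).
    by rewrite expect_cst.
  by rewrite /expect mulr_sumr; apply: eq_bigr => w' _; rewrite mulrA.
transitivity (\sum_(p : {ffun T -> B} * {ffun T -> B})
    mass p.1 * mass p.2 * f (mix p.1 p.2)); last first.
  rewrite -(pair_big predT predT (fun w w' => mass w * mass w' * f (mix w w'))).
  apply: eq_bigr => w _; rewrite /expect mulr_sumr.
  by apply: eq_bigr => w' _; rewrite mulrA.
pose sw (p : {ffun T -> B} * {ffun T -> B}) := (mix p.1 p.2, mix p.2 p.1).
have swK : involutive sw.
  by case=> w w'; congr (_, _); apply/ffunP => t; rewrite !ffunE /= thetaK.
rewrite (reindex_inj (inv_inj swK)); apply: eq_bigr => p _ /=.
congr (_ * _); rewrite /mass -!big_split /=.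
by apply: eq_bigr => t _; rewrite !ffunE mass_theta.
Qed.

Definition splice (S : {pred T}) (w w' : {ffun T -> B}) : {ffun T -> B} :=
  [ffun t => if t \in S then w t else w' t].

Lemma expect_splice (S : {pred T}) f :
  E f = E (fun w => E (fun w' => f (splice S w w'))).
Proof.
apply: (expect_resample (theta := fun t b c => if t \in S then b else c)).
  by move=> t b c /=; case: (t \in S); rewrite // mulrC.
by move=> t b c /=; case: (t \in S).
Qed.

Lemma expect_indep (S : {pred T}) f g :
  (forall w w', f (splice S w w') = f w) ->
  (forall w w', g (splice S w w') = g w') ->
  E (fun w => f w * g w) = E f * E g.
Proof.
move=> fS gS; rewrite (expect_splice S) mulrC -expectZ; apply: eq_expect => w.
by rewrite mulrC -expectZ; apply: eq_expect => w'; rewrite fS gS.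
Qed.

Lemma expect_markov (Q : {ffun T -> B} -> bool) c f : 0 < c ->
  (forall w, 0 <= f w) -> (forall w, Q w -> c <= f w) ->
  E (fun w => (Q w)%:R) <= E f / c.
Proof.
move=> c0 f0 Qf; rewrite ler_pdivlMr // mulrC -expectZ; apply: le_expect => w.
by case: (Q w) (Qf w) => [/(_ isT)|_]; rewrite ?mulr1 ?mulr0.
Qed.

End Basics.
End Expectation.

(** * Elementary estimates *)

Section RealBounds.
Context {R : realFieldType}.
Implicit Types (x d h : R) (N : nat).

Lemma expr_1B_ge_taylor3 x N : 0 <= x <= 1 ->
  1 - N%:R * x + N%:R * (N%:R - 1) / 2 * x ^+ 2
    - N%:R * (N%:R - 1) * (N%:R - 2) / 6 * x ^+ 3 <= (1 - x) ^+ N.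
Proof.
move=> /andP[x0 x1]; elim: N => [|N IH]; first by rewrite expr0; lra.
rewrite [(1 - x) ^+ _]exprSr -natr1; set a : R := N%:R in IH *.
have a3 : 0 <= a * (a - 1) * (a - 2).
  rewrite /a; case: N {IH a} => [|[|N]]; [by rewrite !mul0r | by lra |].
  have : 0 <= (N%:R : R) by exact: ler0n.
  by rewrite -[N.+2]addn2 natrD => ?; rewrite !mulr_ge0 //; lra.
have x1' : 0 <= 1 - x by lra.
have step := ler_wpM2r x1' IH; apply: le_trans _ step.
have : 0 <= a * (a - 1) * (a - 2) * x ^+ 4 by rewrite mulr_ge0 ?exprn_ge0.
by lra.
Qed.

Lemma cubic_le1 h : 0 <= h <= 1 -> (1 - h) * (1 - 2 * h) * (1 - 3 * h) <= 1.
Proof.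
move=> /andP[h0 h1]; have := mulr_ge0 h0 (sqr_ge0 (h - 11 / 12)).
by rewrite expr2; lra.
Qed.

(** For a critical graph the generating function of the number of neighbors is
    evaluated at [1 - d]; the quadratic gain over [1 - d] is what makes critical
    clusters finite. *)
Lemma expr_critical n d : (0 < n)%N -> 0 <= d <= 1 / 2 ->
  1 - d + d ^+ 2 / 3 <= (1 - d / n%:R) ^+ n.-1.
Proof.
case: n => // n _ /andP[d0 d1]; rewrite /=.
set a : R := n.+1%:R.
have a1 : 1 <= a by rewrite /a -natr1 lerDr ler0n.
have nE : n%:R = a - 1 :> R by rewrite /a -natr1 addrK.
clearbody a.
set h := a^-1.
have h0 : 0 <= h by rewrite invr_ge0; lra.
have h1 : h <= 1 by rewrite invf_le1; lra.
have a_neq0 : a != 0 by apply: lt0r_neq0; lra.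
have dh : 0 <= d * h <= 1 by rewrite mulr_ge0 //=; nra.
apply: le_trans _ (expr_1B_ge_taylor3 _ dh).
rewrite nE.
have e1 : (a - 1) * (d * h) = d - d * h by rewrite /h; field.
have e2 : (a - 1) * (a - 1 - 1) / 2 * (d * h) ^+ 2
    = (1 - h) * (1 - 2 * h) * d ^+ 2 / 2.
  by rewrite /h; field.
have e3 : (a - 1) * (a - 1 - 1) * (a - 1 - 2) / 6 * (d * h) ^+ 3
    = (1 - h) * (1 - 2 * h) * (1 - 3 * h) * d ^+ 3 / 6.
  by rewrite /h; field.
rewrite e1 e2 e3.
have := @cubic_le1 h; rewrite h0 h1 => /(_ isT).
set c := (1 - h) * (1 - 2 * h) * (1 - 3 * h) => c1.
have cd : c * d ^+ 3 <= d ^+ 3 by rewrite ler_piMl ?exprn_ge0.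
have : 0 <= d * h * (1 - 3 / 2 * d) by rewrite !mulr_ge0 //; lra.
have : 0 <= d ^+ 2 * (1 - d) by rewrite mulr_ge0 ?exprn_ge0 //; lra.
have : 0 <= d ^+ 2 * h ^+ 2 by rewrite mulr_ge0 ?exprn_ge0.
by move: cd; rewrite !exprS !expr0; lra.
Qed.

Lemma expr_half x N : 0 <= x <= 1 -> 1 <= N%:R * x -> (1 - x) ^+ N <= 1 / 2.
Proof.
move=> /andP[x0 x1] Nx.
have bern : 1 + N%:R * x <= (1 + x) ^+ N.
  elim: N {Nx} => [|N IH]; first by rewrite expr0; lra.
  have x1' : 0 <= 1 + x by lra.
  rewrite exprSr -natr1; have step := ler_wpM2r x1' IH; apply: le_trans _ step.
  have : 0 <= N%:R * x * x by rewrite !mulr_ge0 ?ler0n.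
  by lra.
have : (1 - x) ^+ N * (1 + x) ^+ N <= 1.
  by rewrite -exprMn exprn_ile1 //; nra.
have p0 : 0 <= (1 - x) ^+ N by rewrite exprn_ge0; lra.
by nra.
Qed.

(** This takes the place of the bound of the product by an exponential. The
    product times [1 - s], with [s] the sum, stays at most [1] when factors are
    combined, because [1 - (s1 + s2) <= (1 - s1) * (1 - s2)]. *)
Lemma prod_1D_le (I : finType) (A : {pred I}) (f : I -> R) (S : R) :
  (forall i, 0 <= f i) -> \sum_(i in A) f i <= S -> S < 1 ->
  \prod_(i in A) (1 + f i) <= 1 / (1 - S).
Proof.
move=> f0 fS S1; rewrite ler_pdivlMr; last by lra.
pose K (p s : R) := [/\ 0 <= s, 0 <= p & s < 1 -> p * (1 - s) <= 1] : Prop.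
have [s0 p0 H] : K (\prod_(i in A) (1 + f i)) (\sum_(i in A) f i).
  apply: (big_ind2 K) => [|p1 s1 p2 s2|i _].
  - by split=> //; rewrite subr0 mul1r.
  - move=> [s10 p10 H1] [s20 p20 H2]; split; rewrite ?addr_ge0 ?mulr_ge0 // => s12.
    have H1' : p1 * (1 - s1) <= 1 by apply: H1; lra.
    have H2' : p2 * (1 - s2) <= 1 by apply: H2; lra.
    have : p1 * (1 - s1) * (p2 * (1 - s2)) <= 1.
      by rewrite mulr_ile1 // mulr_ge0 //; lra.
    by have := mulr_ge0 (mulr_ge0 p10 p20) (mulr_ge0 s10 s20); lra.
  - have := f0 i; split => //; first by lra.
    by move=> _; have := mulr_ge0 (f0 i) (f0 i); lra.
apply: le_trans (H _); last by lra.
by rewrite ler_wpM2l //; lra.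
Qed.

Lemma geometric_sum_le (mu : R) N : 0 <= mu < 1 ->
  \sum_(l < N) mu ^+ l <= (1 - mu)^-1.
Proof.
move=> /andP[mu0 mu1]; have mu1' : 0 < 1 - mu by lra.
rewrite -[leRHS]mul1r ler_pdivlMr // mulrC.
have -> : (1 - mu) * \sum_(l < N) mu ^+ l = 1 - mu ^+ N.
  by rewrite -opprB mulNr -subrX1 opprB.
by rewrite lerBlDr lerDl exprn_ge0.
Qed.

(** Multiplying by [1 - mu] lowers the degree of the polynomial weight by one,
    by Abel summation. *)
Lemma quadratic_geometric_sum_le (mu : R) N : 0 <= mu < 1 ->
  \sum_(l < N) l.+1%:R ^+ 2 * mu ^+ l <= 2 / (1 - mu) ^+ 3.
Proof.
move=> /[dup] mu01 /andP[mu0 mu1]; have mu1' : 0 < 1 - mu by lra.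
have lin : \sum_(l < N) l.+1%:R * mu ^+ l <= (1 - mu)^-1 ^+ 2.
  rewrite expr2 ler_pdivlMr // mulrC; apply: le_trans (geometric_sum_le N mu01).
  have -> : (1 - mu) * \sum_(l < N) l.+1%:R * mu ^+ l
      = \sum_(l < N) mu ^+ l - N%:R * mu ^+ N.
    elim: N => [|N IH]; first by rewrite !big_ord0 mul0r; ring.
    by rewrite !big_ord_recr /= mulrDr IH [mu ^+ N.+1]exprS -(natr1 N); ring.
  by rewrite lerBlDr lerDl mulr_ge0 ?exprn_ge0.
rewrite exprS invfM mulrCA -[leRHS]mulrC ler_pdivlMr // mulrC -exprVn.
apply: le_trans (_ : 2 * \sum_(l < N) l.+1%:R * mu ^+ l <= _); last first.
  by rewrite ler_wpM2l.
have -> : (1 - mu) * \sum_(l < N) l.+1%:R ^+ 2 * mu ^+ l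
    = 2 * \sum_(l < N) l.+1%:R * mu ^+ l - \sum_(l < N) mu ^+ l
      - N%:R ^+ 2 * mu ^+ N.
  elim: N {lin} => [|N IH]; first by rewrite !big_ord0 expr0n mul0r; ring.
  by rewrite !big_ord_recr /= mulrDr IH [mu ^+ N.+1]exprS -(natr1 N); ring.
have : 0 <= \sum_(l < N) mu ^+ l by apply: sumr_ge0 => l _; apply: exprn_ge0.
have : 0 <= N%:R ^+ 2 * mu ^+ N by rewrite mulr_ge0 ?exprn_ge0.
by lra.
Qed.

End RealBounds.

(** * Exploration of clusters *)

Section FieldGraph.
Context {V B : finType}.
Implicit Types (Q : pred B) (w : {ffun {set V} -> B}) (U A : {set V}).

(** The value at [{u, v}] decides whether [uv] is an edge. Indexing the field by
    all sets of vertices makes [{u, v}] a coordinate without any proof that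
    [u] and [v] differ. *)
Definition open_pair Q w : rel V := fun u v => (u != v) && Q (w [set u; v]%SET).

Definition cluster Q w (u : V) : {set V} := [set v | connect (open_pair Q w) u v]%SET.

Lemma open_pair_sym Q w : symmetric (open_pair Q w).
Proof. by move=> u v; rewrite /open_pair eq_sym finset.setUC. Qed.

Lemma connect_open_sym Q w : connect_sym (open_pair Q w).
Proof. exact/sym_connect_sym/open_pair_sym. Qed.

Lemma connect_closed (e : rel V) (D : {set V}) x y :
  (forall a b, a \in D -> e a b -> b \in D) ->
  x \in D -> connect e x y -> y \in D.
Proof.
move=> clD xD /connectP[p + ->]; elim: p x xD => //= b p IH x xD /andP[xb].
exact/IH/(clD x).
Qed.

Definition open_pair_in U Q w : rel V := fun x y => [&& x \in U, y \in U & open_pair Q w x y].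

(** The vertices met by an exploration started at [A] that may only visit [U]. *)
Definition reach U A Q w : {set V} :=
  [set v | [exists a in A, connect (open_pair_in U Q w) a v]]%SET.

Definition new_nbrs U A Q w (a : V) : {set V} :=
  [set v in U :\: A | Q (w [set a; v])]%SET.

Lemma reachT1 Q w u : reach [set: V]%SET [set u]%SET Q w = cluster Q w u.
Proof.
apply/setP => v; rewrite !inE.
have e x y : connect (open_pair_in [set: V]%SET Q w) x y = connect (open_pair Q w) x y.
  by apply: eq_connect => a b; rewrite /open_pair_in !inE.
apply/existsP/idP => [[x /andP[/set1P -> ]]|uv]; first by rewrite e.
by exists u; rewrite set11 e.
Qed.

Lemma reach0 U Q w : reach U finset.set0 Q w = finset.set0.
Proof.
apply/setP => v; rewrite !inE; apply/existsP => [[x]].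
by rewrite inE.
Qed.

Lemma reach_sub U A Q w : A \subset U -> reach U A Q w \subset U.
Proof.
move=> /fintype.subsetP AU; apply/fintype.subsetP => v; rewrite inE => /existsP[a /andP[/AU aU]].
by apply: connect_closed aU => x y _ /and3P[].
Qed.

Lemma frontier_sub U A Q w a : A \subset U -> a \in A ->
  A :\ a :|: new_nbrs U A Q w a \subset U :\ a.
Proof.
move=> AU aA; apply/fintype.subsetP => x; rewrite !inE.
case/orP => [/andP[-> xA]|]; first by rewrite (fintype.subsetP AU).
move=> /andP[/andP[xA ->] _]; rewrite andbT.
by apply: contraNneq xA => ->.
Qed.

(** One step of exploration: [a] is removed from the available vertices, and its
    neighbors that were not yet found become starting points. *)
Lemma reach_step U A Q w a : A \subset U -> a \in A ->
  reach U A Q w =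
  a |: reach (U :\ a) (A :\ a :|: new_nbrs U A Q w a) Q w.
Proof.
move=> /[dup] AU /fintype.subsetP sAU aA.
set U' := U :\ a; set A' := A :\ a :|: _.
have aU := sAU _ aA.
have mono x y : connect (open_pair_in U' Q w) x y -> connect (open_pair_in U Q w) x y.
  apply: connect_sub => {}x {}y /and3P[].
  rewrite !inE => /andP[_ xU] /andP[_ yU] xy.
  by apply: connect1; rewrite /open_pair_in xU yU.
have A'U' : A' \subset U'.
  exact: frontier_sub.
have inA' x : x \in A' -> x \in reach U' A' Q w.
  by move=> xA'; rewrite inE; apply/existsP; exists x; rewrite xA' connect0.
apply/eqP; rewrite finset.eqEsubset; apply/andP; split; apply/fintype.subsetP => v; last first.
  rewrite in_setU1 => /orP[/eqP -> |].
    by rewrite inE; apply/existsP; exists a; rewrite aA connect0.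
  rewrite !inE => /existsP[x /andP[+ /mono xv]].
  rewrite !inE => /orP[/andP[_ xA]|].
    by apply/existsP; exists x; rewrite xA.
  move=> /andP[/andP[xA xU] ax]; apply/existsP; exists a; rewrite aA /=.
  apply: connect_trans xv; apply: connect1.
  rewrite /open_pair_in aU xU /open_pair ax andbT /=.
  by apply: contraNneq xA => <-.
rewrite inE => /existsP[x /andP[xA]].
apply: connect_closed => [b y|]; last first.
  rewrite in_setU1; case: eqP => //= /eqP xa; apply: inA'.
  by rewrite !inE xa xA.
rewrite !in_setU1 => /orP[/eqP ->|bR] /and3P[_ yU ay].
  case: eqP => //= /eqP ya; apply: inA'; rewrite !inE ya yU /=.
  by case: (y \in A) => //=; case/andP: ay.
case: eqP => //= /eqP ya.
have bU' := fintype.subsetP (reach_sub Q w A'U') _ bR.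
move: bR; rewrite !inE => /existsP[c /andP[cA' cb]].
apply/existsP; exists c; rewrite cA' /=.
apply: connect_trans cb (connect1 _).
by rewrite /open_pair_in bU' ay !inE ya yU.
Qed.

End FieldGraph.

Section Exploration.
Context {R : realFieldType} {V B : finType} (m : B -> R) (Q : pred B).
Hypothesis m_pmf : is_pmf m.
Variables z F : V -> R.
Implicit Types (w : {ffun {set V} -> B}) (U A : {set V}).
Let q := pr m Q.

Definition explored U A : R := expect m (fun w => \prod_(v in reach U A Q w) z v).

Definition incident (a : V) : {pred {set V}} := fun e => a \in e.

Lemma incidentE a e : (e \in incident a) = (a \in e). Proof. by []. Qed.

Lemma open_pair_in_splice U a w w' :
  open_pair_in (U :\ a) Q (splice (incident a) w w') =2 open_pair_in (U :\ a) Q w'.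
Proof.
move=> x y; rewrite /open_pair_in /open_pair ffunE incidentE !inE.
by rewrite ![a == _]eq_sym; case: (x == a); case: (y == a); rewrite ?andbF.
Qed.

Lemma reach_splice U A a w w' :
  reach (U :\ a) A Q (splice (incident a) w w') = reach (U :\ a) A Q w'.
Proof.
apply/setP => v; rewrite !inE; apply: eq_existsb => b.
by rewrite (eq_connect (@open_pair_in_splice U a w w')).
Qed.

Lemma new_nbrs_splice U A a w w' :
  new_nbrs U A Q (splice (incident a) w w') a = new_nbrs U A Q w a.
Proof. by apply/setP => v; rewrite !inE ffunE incidentE !inE eqxx. Qed.

(** Exploring [a] reveals the coordinates of the pairs containing [a] and nothing
    else, so the rest is a fresh exploration of the remaining vertices. *)
Lemma explored_step U A a : A \subset U -> a \in A ->
  explored U A = z a * expect m (fun w =>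
    explored (U :\ a) (A :\ a :|: new_nbrs U A Q w a)).
Proof.
move=> AU aA; rewrite /explored (expect_splice m_pmf (incident a)) -expectZ.
apply: eq_expect => w; rewrite -expectZ; apply: eq_expect => w'.
rewrite (reach_step Q _ AU aA) big_setU1 /=; last first.
  have /fintype.subsetP h : reach (U :\ a) (A :\ a :|: new_nbrs U A Q w a) Q w'
    \subset U :\ a by apply: reach_sub; apply: frontier_sub.
  by rewrite reach_splice new_nbrs_splice; apply/negP => /h; rewrite !inE eqxx.
by rewrite reach_splice new_nbrs_splice.
Qed.

Lemma expect_new_nbrs U A a : a \in A ->
  expect m (fun w => \prod_(v in new_nbrs U A Q w a) F v)
  = \prod_(v in U :\: A) (1 + q * (F v - 1)).
Proof.
move=> aA.
transitivity (expect m (fun w => \prod_(v in U :\: A)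
    (if Q (w [set a; v]%SET) then F v else 1))).
  apply: eq_expect => w; rewrite -big_mkcondr /=.
  by apply: eq_bigl => v; rewrite !inE.
rewrite (expect_prod m_pmf (h := fun v => [set a; v]%SET)
  (fun v b => if Q b then F v else 1)); last first.
  move=> x y; rewrite !inE => /andP[xA _] /andP[yA _] /setP/(_ x).
  rewrite !inE eqxx orbT; case: (eqVneq x a) => [xa|_ /esym/eqP //].
  by rewrite xa aA in xA.
by apply: eq_bigr => v _; rewrite sum_pmf_if // -/q; ring.
Qed.

Lemma prod_frontier U A a w : a \in A ->
  \prod_(v in A :\ a :|: new_nbrs U A Q w a) F v
  = \prod_(v in A :\ a) F v * \prod_(v in new_nbrs U A Q w a) F v.
Proof.
move=> aA; rewrite -bigU; first by apply: eq_bigl => v; rewrite !inE.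
rewrite disjoint_subset; apply/fintype.subsetP => v; rewrite !inE => /andP[_ ->].
by [].
Qed.

Hypothesis (z_ge0 : forall v, 0 <= z v) (F_ge0 : forall v, 0 <= F v).

(** A supersolution [F] of the fixed-point inequality of the multitype branching
    process that dominates the exploration bounds the generating function of
    the cluster: by induction on the available vertices, since an exploration
    started at [A] behaves at most like independent explorations started at the
    vertices of [A]. Quantifying over all [W] accounts for vertices already
    removed. *)
Lemma explored_le U A : A \subset U ->
  (forall a (W : {set V}), a \notin W ->
     z a * \prod_(v in W) (1 + q * (F v - 1)) <= F a) ->
  explored U A <= \prod_(v in A) F v.
Proof.
move=> + Fsuper; have [k] := ubnP #|U|; elim: k U A => // k IH U A leUk AU.
have [->|[a aA]] := set_0Vmem A.
  rewrite /explored big_set0 (@eq_expect _ _ _ _ _ (fun=> 1)) ?expect_cst // => w.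
  by rewrite reach0 big_set0.
have aU := fintype.subsetP AU _ aA.
rewrite (explored_step AU aA).
apply: le_trans (_ : z a * (\prod_(v in A :\ a) F v *
    \prod_(v in U :\: A) (1 + q * (F v - 1))) <= _).
  rewrite ler_wpM2l //.
  rewrite -(expect_new_nbrs _ aA) -expectZ; apply: le_expect => // w.
  rewrite -prod_frontier //; apply: IH; last exact: frontier_sub.
  by move: leUk; rewrite (cardsD1 a) aU.
rewrite mulrCA (big_setD1 a aA) /= mulrC ler_wpM2r ?prodr_ge0 //.
by apply: Fsuper; rewrite !inE aA.
Qed.

(** The same comparison from below. It is useful for weights at most [1], where
    a bound from below on the generating function is a bound from above on
    the tail of the cluster size. *)
Lemma explored_ge U A : A \subset U ->
  (forall a (W : {set V}), a \notin W ->
     F a <= z a * \prod_(v in W) (1 + q * (F v - 1))) ->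
  \prod_(v in A) F v <= explored U A.
Proof.
move=> + Fsub; have [k] := ubnP #|U|; elim: k U A => // k IH U A leUk AU.
have [->|[a aA]] := set_0Vmem A.
  rewrite /explored big_set0 (@eq_expect _ _ _ _ _ (fun=> 1)) ?expect_cst // => w.
  by rewrite reach0 big_set0.
have aU := fintype.subsetP AU _ aA.
rewrite (explored_step AU aA).
apply: le_trans (_ : _ <= z a * (\prod_(v in A :\ a) F v *
    \prod_(v in U :\: A) (1 + q * (F v - 1)))) _.
  rewrite mulrCA (big_setD1 a aA) /= mulrC ler_wpM2l ?prodr_ge0 //.
  by apply: Fsub; rewrite !inE aA.
rewrite ler_wpM2l //.
rewrite -(expect_new_nbrs _ aA) -expectZ; apply: le_expect => // w.
rewrite -prod_frontier //; apply: IH; last exact: frontier_sub.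
by move: leUk; rewrite (cardsD1 a) aU.
Qed.

End Exploration.

(** * Tails of critical and subcritical clusters *)

Section ClusterTails.
Context {R : realFieldType} {V B : finType} (m : B -> R).
Hypothesis m_pmf : is_pmf m.
Implicit Types (Q : pred B) (w : {ffun {set V} -> B}) (u : V).
Local Notation n := #|V|.
Local Notation E := (@expect R B {set V} m).

Lemma expect_cluster Q (z : V -> R) u :
  E (fun w => \prod_(v in cluster Q w u) z v) = explored m Q z [set: V]%SET [set u]%SET.
Proof. by apply: eq_expect => w; rewrite reachT1. Qed.

Lemma card_notin_lt (W : {set V}) a : a \notin W -> (#|W| <= n.-1)%N.
Proof.
move=> aW; rewrite -ltnS prednK; last by apply/card_gt0P; exists a.
rewrite -cardsT; apply: proper_card; rewrite properT.
by apply: contraNneq aW => ->; rewrite inE.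
Qed.

(** With [d] of order [s ^ (-1/2)] this is the tail of the total progeny of a
    critical branching process. The constant [1 - d] is a subsolution for the
    weight [z = 1 - d ^ 2 / 4], and [z ^ s <= 1 / 2] turns the estimate of
    [1 - E (z ^ #|C|)] into one of the tail. *)
Lemma critical_cluster_tail Q (d : R) s u :
  n%:R * pr m Q <= 1 -> 0 < d <= 1 / 2 -> 4 <= s%:R * d ^+ 2 ->
  E (fun w => ((s <= #|cluster Q w u|)%N)%:R) <= 2 * d.
Proof.
set q := pr m Q => nq /andP[d0 d1] sd.
have q0 : 0 <= q by exact: pr_ge0.
have n0 : (0 < n)%N by apply/card_gt0P; exists u.
have n0R : 0 < (n%:R : R) by rewrite ltr0n.
set z : R := 1 - d ^+ 2 / 4.
have d2 : 0 <= d ^+ 2 <= 1 / 4 by rewrite expr2; nra.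
have z01 : 0 <= z <= 1 by rewrite /z; lra.
have gen : 1 - d <= E (fun w => z ^+ #|cluster Q w u|).
  rewrite (@eq_expect _ _ _ _ _ (fun w => \prod_(v in cluster Q w u) z));
    last by move=> w; rewrite prodr_const.
  rewrite expect_cluster [leLHS](_ : _ = \prod_(v in [set u]%SET) (1 - d));
    last by rewrite big_set1.
  apply: explored_ge; rewrite ?finset.subsetT //; [by move=> _; lra|by move=> _; lra|].
  move=> a W aW; rewrite prodr_const -/q.
  have qd : q * d <= d / n%:R.
    by rewrite ler_pdivlMr // mulrAC; have := ler_wpM2r (ltW d0) nq; lra.
  have dn : 0 <= d / n%:R <= 1.
    apply/andP; split; first by rewrite divr_ge0 //; lra.
    rewrite ler_pdivrMr // mul1r.
    have : 1 <= n%:R :> R by rewrite ler1n.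
    by lra.
  have base : 0 <= 1 - d / n%:R <= 1 + q * (1 - d - 1) by lra.
  have low : 1 - d + d ^+ 2 / 3 <= (1 + q * (1 - d - 1)) ^+ #|W|.
    apply: le_trans (expr_critical n0 _) _; first by lra.
    apply: le_trans (_ : (1 - d / n%:R) ^+ #|W| <= _); last first.
      by apply: lerXn2r; rewrite ?nnegrE; lra.
    by apply: ler_wiXn2l (card_notin_lt aW); lra.
  apply: le_trans (ler_wpM2l _ low); last by lra.
  rewrite /z; have : 0 <= d ^+ 2 * (d - d ^+ 2 / 3).
    by rewrite mulr_ge0 //; [lra | rewrite expr2; nra].
  by rewrite !expr2 in d2 *; lra.
have zs : z ^+ s <= 1 / 2 by apply: expr_half; lra.
apply: le_trans (_ : E (fun w => 2 * (1 + -1 * z ^+ #|cluster Q w u|)) <= _).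
  apply: le_expect => // w; case: leqP => [sC|_] /=.
    have : z ^+ #|cluster Q w u| <= 1 / 2.
      by apply: le_trans zs; apply: ler_wiXn2l sC; lra.
    by clear; move: (z ^+ _) => y; lra.
  have : z ^+ #|cluster Q w u| <= 1 by apply: exprn_ile1; lra.
  by clear; move: (z ^+ _) => y; lra.
rewrite expectZ expectD expectZ expect_cst //.
by move: gen; clear; move: (E _) => y; lra.
Qed.

(** If some cluster is large then many vertices lie in a large cluster: Markov's
    inequality for the number of these vertices improves the union bound by a
    factor [s]. *)
Lemma critical_max_tail Q (d : R) s :
  n%:R * pr m Q <= 1 -> 0 < d <= 1 / 2 -> 4 <= s%:R * d ^+ 2 -> (0 < s)%N ->
  E (fun w => [exists u, (s <= #|cluster Q w u|)%N]%:R)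
  <= n%:R * (2 * d) / s%:R.
Proof.
move=> nq d01 sd s0; pose f w : R := \sum_u ((s <= #|cluster Q w u|)%N)%:R.
apply: le_trans (_ : E f / s%:R <= _).
  apply: (expect_markov m_pmf); rewrite ?ltr0n //.
    by move=> w; apply: sumr_ge0 => u _.
  move=> w /existsP[u su]; apply: le_trans (_ : #|cluster Q w u|%:R <= _).
    by rewrite ler_nat.
  rewrite /f -sum1_card natr_sum.
  rewrite [leRHS](bigID [pred v | v \in cluster Q w u]) /=.
  rewrite -[leLHS]addr0; apply: lerD; last by apply: sumr_ge0.
  apply: ler_sum => v; rewrite !inE => uv.
  suff -> : cluster Q w v = cluster Q w u by rewrite su.
  apply/setP => x; rewrite !inE.
  by rewrite (same_connect (@connect_open_sym _ _ Q w) uv).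
rewrite ler_wpM2r ?invr_ge0 // expect_sum.
apply: le_trans (_ : \sum_(u : V) 2 * d <= _).
  by apply: ler_sum => u _; apply: critical_cluster_tail.
by rewrite sumr_const [leRHS]mulr_natl.
Qed.

(** The cluster of a vertex of a small set [A] is unlikely to come back to [A].
    The constant [(1 - nu) ^ 2 / 8] leaves room for [1 + (1 - nu) / 2] outside
    [A] and [alpha] on [A] to be a supersolution for the weight [alpha / 2] on
    [A], with [alpha] of order [n / #|A|]; this large weight makes six visits
    cost [alpha ^ 6], against the value [alpha] of the supersolution at [u]. *)
Lemma subcritical_cluster_meets Q (nu alpha : R) (A : {set V}) u :
  n%:R * pr m Q <= nu -> 0 <= nu < 1 -> 2 <= alpha ->
  alpha * #|A|%:R <= (1 - nu) ^+ 2 / 8 * n%:R -> u \in A ->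
  E (fun w => ((6 <= #|cluster Q w u :&: A|)%N)%:R) <= 64 / alpha ^+ 5.
Proof.
set q := pr m Q => nq /andP[nu0 nu1] a2 aA uA.
have q0 : 0 <= q by exact: pr_ge0.
pose beta : R := (1 - nu) / 2.
pose z v : R := if v \in A then alpha / 2 else 1.
pose F v : R := if v \in A then alpha else 1 + beta.
have a0 : 0 < alpha by lra.
have b0 : 0 < beta by rewrite /beta; lra.
have z1 v : 1 <= z v by rewrite /z; case: ifP => _; lra.
have F1 v : 1 <= F v by rewrite /F /beta; case: ifP => _; lra.
have z0 v : 0 <= z v by have := z1 v; lra.
have F0 v : 0 <= F v by have := F1 v; lra.
have genE w : \prod_(v in cluster Q w u) z v
    = (alpha / 2) ^+ #|cluster Q w u :&: A|.
  rewrite -prodr_const /z -big_mkcondr /=.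
  by apply: eq_bigl => v; rewrite !inE.
have gen : E (fun w => \prod_(v in cluster Q w u) z v) <= alpha.
  rewrite expect_cluster.
  have -> : alpha = \prod_(v in [set u]%SET) F v by rewrite big_set1 /F uA.
  apply: explored_le; rewrite ?finset.subsetT // => a W _.
  have S : \sum_(v in W) q * (F v - 1) <= 1 - 1 / (1 + beta).
    apply: le_trans (_ : nu * ((1 - nu) ^+ 2 / 8 + beta) <= _); last first.
      rewrite lerBrDr -lerBrDl ler_pdivrMr; last by rewrite /beta; lra.
      rewrite /beta; have : 0 <= (1 - nu) ^+ 2 * (1 - nu) by rewrite mulr_ge0 ?sqr_ge0; lra.
      have : 0 <= (1 - nu) ^+ 2 by rewrite sqr_ge0.
      rewrite !expr2; nra.
    apply: le_trans (_ : q * (alpha * #|A|%:R + beta * n%:R) <= _); last first.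
      apply: le_trans (_ : q * (n%:R * ((1 - nu) ^+ 2 / 8 + beta)) <= _).
        by rewrite ler_wpM2l //; lra.
      rewrite mulrA [q * _]mulrC ler_wpM2r //.
      by have := sqr_ge0 (1 - nu); lra.
    rewrite -mulr_sumr ler_wpM2l //.
    apply: le_trans (_ : \sum_v (F v - 1) <= _).
      rewrite [leRHS](bigID [pred v | v \in W]) /= lerDl.
      by apply: sumr_ge0 => v _; have := F1 v; lra.
    rewrite (bigID [pred v | v \in A]) /=; apply: lerD.
      rewrite (eq_bigr (fun=> alpha - 1)); last by move=> v vA; rewrite /F vA.
      by rewrite sumr_const -[leLHS]mulr_natr ler_wpM2r ?ler0n //; lra.
    rewrite (eq_bigr (fun=> beta)); last first.
      by move=> v /negbTE vA; rewrite /F vA addrAC subrr add0r.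
    rewrite sumr_const -[leLHS]mulr_natr ler_wpM2l ?ler_nat ?max_card //.
    by rewrite /beta; lra.
  have P : \prod_(v in W) (1 + q * (F v - 1)) <= 1 + beta.
    apply: le_trans (prod_1D_le _ S _) _.
    - by move=> v; rewrite mulr_ge0 //; have := F1 v; lra.
    - by rewrite ltrBlDr ltrDl divr_gt0; lra.
    - by rewrite subKr !div1r invrK.
  have P2 := ler_wpM2l (z0 a) P.
  apply: le_trans P2 _; rewrite /z /F; case: ifP => _; last by lra.
  have : beta <= 1 / 2 by rewrite /beta; lra.
  by move=> ?; nra.
apply: le_trans (_ : alpha / (alpha / 2) ^+ 6 <= _); last first.
  rewrite exprMn exprS exprVn; have : alpha != 0 by lra.
  move=> aN0; rewrite le_eqVlt; apply/orP; left; apply/eqP; field.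
  by [].
apply: le_trans (_ : E (fun w => \prod_(v in cluster Q w u) z v) / (alpha / 2) ^+ 6 <= _).
  apply: (expect_markov m_pmf); first by rewrite exprn_gt0 //; lra.
    by move=> w; apply: prodr_ge0.
  by move=> w h; rewrite genE; apply: ler_weXn2l => //; lra.
by rewrite ler_wpM2r // invr_ge0 exprn_ge0 //; lra.
Qed.

End ClusterTails.

Section JointClusters.
Context {R : realFieldType} {V B : finType} (m : B -> R).
Hypothesis m_pmf : is_pmf m.
Implicit Types (Q : pred B) (w : {ffun {set V} -> B}) (u : V).
Local Notation n := #|V|.
Local Notation E := (@expect R B {set V} m).

(** The map [theta] makes the two graphs independent: it assembles a value from
    the data relevant for [Qb] in one copy and those relevant for [Qa] in
    another one. Conditionally on the critical graph [Qb], whose clusters are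
    smaller than [r ^ 6] with high probability, the subcritical clusters are
    fresh. Up to constants, and with [r] of order [n ^ (1/8)], the failure
    probabilities are [n * r ^ (-3) * r ^ (-6)] and [n * (r ^ 6 / n) ^ 5]. *)
Lemma joint_clusters_small (Qa Qb : pred B) (theta : B -> B -> B) (nu : R) r :
  (forall b c, m (theta b c) * m (theta c b) = m b * m c) ->
  (forall b c, theta (theta b c) (theta c b) = b) ->
  (forall b c, Qb (theta b c) = Qb b) -> (forall b c, Qa (theta b c) = Qa c) ->
  n%:R * pr m Qb <= 1 -> n%:R * pr m Qa <= nu -> 0 <= nu < 1 ->
  (2 <= r)%N -> 2 <= (1 - nu) ^+ 2 / 8 * r%:R :> R ->
  (r ^ 8 <= n <= 256 * r ^ 8)%N ->
  E (fun w => [exists u, (6 <= #|cluster Qa w u :&: cluster Qb w u|)%N]%:R)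
  <= (1024 + 16384 / ((1 - nu) ^+ 2 / 8) ^+ 5) / r%:R.
Proof.
move=> m_theta thetaK Qb_theta Qa_theta nqb nqa nu01 r2 er /andP[r8 n8].
set eps := (1 - nu) ^+ 2 / 8 in er *.
have r1R : 2 <= r%:R :> R by rewrite ler_nat.
have eps0 : 0 < eps by apply: divr_gt0; [apply: exprn_gt0; lra|lra].
set rr : R := r%:R in er r1R *.
have r0 : 0 < rr by lra.
have n8R : n%:R <= 256 * rr ^+ 8.
  by rewrite /rr -natrX -natrM ler_nat.
have r8R : rr ^+ 8 <= n%:R by rewrite /rr -natrX ler_nat.
have rn k : 0 < rr ^+ k by rewrite exprn_gt0.
(* The choice of [d] makes [s * d ^ 2 = 4], as the critical tail requires. *)
pose s := (r ^ 6)%N; pose d : R := 2 / rr ^+ 3.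
pose big_b w := [exists u, (s <= #|cluster Qb w u|)%N].
pose meet u w :=
  (#|cluster Qb w u| < s)%N && (6 <= #|cluster Qa w u :&: cluster Qb w u|)%N.
pose alpha : R := eps * n%:R / rr ^+ 6.
have alphaE : eps * rr ^+ 2 <= alpha.
  rewrite /alpha ler_pdivlMr // -mulrA -exprD ler_wpM2l //; exact: ltW.
have err : eps * rr <= eps * rr ^+ 2.
  by rewrite ler_wpM2l ?ltW // expr2; nra.
apply: le_trans (_ : E (fun w => (big_b w)%:R + \sum_u (meet u w)%:R) <= _).
  apply: le_expect => // w.
  have S0 : 0 <= \sum_u (meet u w)%:R :> R by apply: sumr_ge0.
  have [bw|/existsPn small] := boolP (big_b w).
    by case: existsP => _ /=; lra.
  rewrite add0r; case: existsP => // -[u hu].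
  rewrite (bigD1 u) //= /meet hu ltnNge small lerDl.
  by apply: sumr_ge0.
rewrite expectD expect_sum mulrDl; apply: lerD.
  apply: le_trans (critical_max_tail m_pmf (d := d) nqb _ _ _) _.
  - rewrite divr_gt0 //= ler_pdivrMr // !exprS expr0; nra.
  - rewrite /s natrX -/rr (_ : _ * _ = 4) // /d; field; exact: lt0r_neq0.
  - by rewrite expn_gt0 (leq_trans _ r2).
  rewrite /s natrX -/rr /d ler_pdivrMr //.
  apply: le_trans (ler_wpM2r _ n8R) _.
    by rewrite !mulr_ge0 ?invr_ge0 ?ltW.
  rewrite le_eqVlt; apply/orP; left; apply/eqP; field; exact: lt0r_neq0.
have meet_le u : E (fun w => (meet u w)%:R) <= 64 / alpha ^+ 5.
  rewrite (expect_resample m_pmf (theta := fun=> theta)) //.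
  rewrite -[leRHS](expect_cst {set V} m_pmf); apply: le_expect => // w.
  have openb w' : open_pair Qb [ffun t => theta (w t) (w' t)] =2 open_pair Qb w.
    by move=> x y; rewrite /open_pair ffunE Qb_theta.
  have opena w' : open_pair Qa [ffun t => theta (w t) (w' t)] =2 open_pair Qa w'.
    by move=> x y; rewrite /open_pair ffunE Qa_theta.
  have clb w' : cluster Qb [ffun t => theta (w t) (w' t)] u = cluster Qb w u.
    by apply/setP => x; rewrite !inE (eq_connect (openb w')).
  have cla w' : cluster Qa [ffun t => theta (w t) (w' t)] u = cluster Qa w' u.
    by apply/setP => x; rewrite !inE (eq_connect (opena w')).
  have [small|big] := ltnP #|cluster Qb w u| s; last first.
    apply: le_trans (_ : E (fun=> 0) <= _); last first.
      by rewrite expect_cst // divr_ge0 ?exprn_ge0 //; lra.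
    by apply: le_expect => // w'; rewrite /meet clb ltnNge big.
  rewrite (@eq_expect _ _ _ _ _
    (fun w' => (6 <= #|cluster Qa w' u :&: cluster Qb w u|)%N%:R)); last first.
    by move=> w'; rewrite /meet clb cla small.
  apply: (subcritical_cluster_meets m_pmf nqa nu01) => //; first by lra.
    rewrite -/eps /alpha mulrAC ler_pdivrMr // ler_wpM2l //.
      by rewrite mulr_ge0 ?ler0n ?ltW.
    by rewrite /rr -natrX ler_nat ltnW.
  by rewrite inE connect0.
apply: le_trans (_ : n%:R * (64 / alpha ^+ 5) <= _).
  apply: le_trans (_ : \sum_(u : V) 64 / alpha ^+ 5 <= _).
    by apply: ler_sum => u _; apply: meet_le.
  by rewrite sumr_const [leRHS]mulr_natl.
have a5 : (eps * rr ^+ 2) ^+ 5 <= alpha ^+ 5.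
  by apply: lerXn2r => //; rewrite nnegrE; [rewrite mulr_ge0 ?ltW|lra].
have e5 : 0 < (eps * rr ^+ 2) ^+ 5 by rewrite exprn_gt0 // mulr_gt0.
apply: le_trans (_ : n%:R * (64 / (eps * rr ^+ 2) ^+ 5) <= _).
  rewrite ler_wpM2l ?ler0n // ler_wpM2l // lef_pV2 // posrE //.
  exact: lt_le_trans a5.
apply: le_trans (ler_wpM2r _ n8R) _; first by rewrite divr_ge0 // ltW.
apply: le_trans (_ : 16384 / eps ^+ 5 / rr ^+ 2 <= _).
  rewrite le_eqVlt; apply/orP; left; apply/eqP; field.
  by rewrite !lt0r_neq0.
apply: ler_wpM2l.
  by apply: divr_ge0; [exact: ler0n | exact/exprn_ge0/ltW].
by rewrite lef_pV2 ?posrE // expr2 ler_pMl //; lra.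
Qed.

End JointClusters.

(** * Simple paths and expected numbers of path defects *)

Section SimplePaths.
Context {V B : finType}.
Implicit Types (Q : pred B) (w : {ffun {set V} -> B}) (p : seq V) (x y u : V).

Definition path_edges x p : seq {set V} := pairmap (fun a b => [set a; b]%SET) x p.

Lemma path_edges_sub x p e v : e \in path_edges x p -> v \in e -> v \in x :: p.
Proof.
elim: p x => //= y p IH x; rewrite inE => /orP[/eqP ->|/IH h].
  by rewrite !inE => /orP[->|->]; rewrite ?orbT.
by move=> /h yp; rewrite in_cons yp orbT.
Qed.

Lemma path_edges_uniq x p : uniq (x :: p) -> uniq (path_edges x p).
Proof.
elim: p x => //= y p IH x /andP[xyp /IH ->]; rewrite andbT.
apply: contra xyp => /path_edges_sub; apply.
by rewrite !inE eqxx.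
Qed.

Lemma size_path_edges x p : size (path_edges x p) = size p.
Proof. exact: size_pairmap. Qed.

Lemma path_edges_open Q w x p : path (open_pair Q w) x p ->
  forall e, e \in path_edges x p -> Q (w e).
Proof.
elim: p x => //= y p IH x /andP[/andP[_ Qxy] /IH h] e.
by rewrite inE => /orP[/eqP -> //|/h].
Qed.

Lemma path_edges_split x s e : e \in path_edges x s ->
  exists q b r, s = q ++ b :: r /\ e = [set seq.last x q; b]%SET.
Proof.
elim: s x => //= y s IH x; rewrite inE => /orP[/eqP ->|/IH[q [b [r [-> ->]]]]].
  by exists [::], y, s.
by exists (y :: q), b, r.
Qed.

Lemma path_open_weaken Q (Q' : pred B) w x s : path (open_pair Q w) x s ->
  (forall e, e \in path_edges x s -> Q' (w e)) -> path (open_pair Q' w) x s.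
Proof.
elim: s x => //= y s IH x /andP[/andP[xy _] ps] h.
rewrite /open_pair xy h ?mem_head //= IH // => e es.
by apply: h; rewrite inE es orbT.
Qed.

Lemma size_simple_path x p : uniq (x :: p) -> (size p < #|V|)%N.
Proof. by move=> /card_uniqP /= <-; apply: max_card. Qed.

Lemma connect_simple_path (e : rel V) x y : connect e x y ->
  exists p, [/\ path e x p, uniq (x :: p) & last x p = y].
Proof.
by move=> /connectP[p ep ->]; case/shortenP: ep => p' ep' up' _; exists p'.
Qed.

Definition open_pair_off (E : seq {set V}) Q w : rel V :=
  fun x y => open_pair Q w x y && ([set x; y]%SET \notin E).

Lemma connect_off_sub E Q w x y :
  connect (open_pair_off E Q w) x y -> connect (open_pair Q w) x y.
Proof. by apply: connect_sub => a b /andP[ab _]; apply: connect1. Qed.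

(** If a closed edge of a simple path can be bypassed, then two vertices on
    either side of it are joined by open edges off the path: otherwise the set
    of vertices so joined to the first side would be left by no open edge, yet
    it contains one end of an open path and not the other. *)
Lemma bypass Q w u p b r : uniq (u :: p ++ b :: r) ->
  ~~ Q (w [set last u p; b]%SET) ->
  connect (open_pair Q w) u (last b r) ->
  exists x y, [/\ x \in u :: p ++ b :: r, y \in u :: p ++ b :: r, x != y &
    connect (open_pair_off (path_edges u (p ++ b :: r)) Q w) x y].
Proof.
move=> uq ncl con; set es := path_edges _ _; set e := open_pair_off es Q w.
have esE : es = path_edges u p ++ [set last u p; b]%SET :: path_edges b r.
  by rewrite /es /path_edges pairmap_cat.
move: uq; rewrite -cat_cons cat_uniq => /and3P[_ /hasPn disj _].
pose D := [set v | [exists x, (x \in u :: p) && connect e x v]]%SET.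
have [/existsP[y /andP[yr]]|none] := boolP [exists y, (y \in b :: r) && (y \in D)].
  rewrite inE => /existsP[x /andP[xp xy]]; exists x, y.
  split; rewrite ?mem_cat ?xp ?yr ?orbT //.
  by apply: contraTneq xp => ->; apply: disj.
have uD : u \in D.
  by rewrite inE; apply/existsP; exists u; rewrite mem_head connect0.
have : last b r \in D.
  apply: connect_closed uD con => x y xD xy.
  have [xyE|xyE] := boolP ([set x; y]%SET \in es); last first.
    move: xD; rewrite !inE => /existsP[z /andP[zp zx]].
    apply/existsP; exists z; rewrite zp /=.
    by apply: connect_trans zx (connect1 _); rewrite /e /open_pair_off xy.
  move: xyE; rewrite esE mem_cat inE => /or3P[xyE|/eqP xyE|xyE].
  - have yp : y \in u :: p by apply: path_edges_sub xyE _; rewrite !inE eqxx orbT.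
    by rewrite inE; apply/existsP; exists y; rewrite yp connect0.
  - by move: ncl; rewrite -xyE; case/andP: xy => _ ->.
  - have xr : x \in b :: r by apply: path_edges_sub xyE _; rewrite !inE eqxx.
    by case/existsP: none; exists x; rewrite xr xD.
by move=> lD; case/existsP: none; exists (last b r); rewrite mem_last lD.
Qed.

End SimplePaths.

Section PathCounts.
Context {R : realFieldType} {V B : finType} (m : B -> R).
Hypothesis m_pmf : is_pmf m.
Implicit Types (Q : pred B) (w : {ffun {set V} -> B}) (p : seq V) (x y u : V).
Local Notation n := #|V|.
Local Notation E := (@expect R B {set V} m).

(** The edges of a simple path are distinct, and independent of everything that
    happens off the path. *)
Lemma expect_path_indep Q x p (f : {ffun {set V} -> B} -> R) :
  uniq (x :: p) -> (forall w, 0 <= f w) ->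
  (forall w w', f (splice [in path_edges x p] w w') = f w') ->
  E (fun w => (path (open_pair Q w) x p)%:R * f w) <= pr m Q ^+ size p * E f.
Proof.
move=> up f0 fE.
pose op w : R := \prod_(e in path_edges x p) (Q (w e))%:R.
apply: le_trans (_ : E (fun w => op w * f w) <= _).
  apply: le_expect => // w; rewrite ler_wpM2r //.
  case: (boolP (path _ _ _)) => [pa|_]; last by apply: prodr_ge0.
  by rewrite /op big1 // => e /(path_edges_open pa) ->.
rewrite (expect_indep m_pmf (S := [in path_edges x p])) //; last first.
  by move=> w w'; apply: eq_bigr => e ein; rewrite ffunE ein.
rewrite (expect_prod m_pmf (h := id) (fun _ b => (Q b)%:R)) //.
rewrite (eq_bigr (fun=> pr m Q)); last by move=> e _; rewrite sum_pmf_indic.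
rewrite prodr_const (_ : #|_| = size p) // -(size_path_edges x p).
exact/card_uniqP/path_edges_uniq.
Qed.

Lemma expect_path Q x p : uniq (x :: p) ->
  E (fun w => (path (open_pair Q w) x p)%:R) <= pr m Q ^+ size p.
Proof.
move=> up; have := @expect_path_indep Q x p (fun=> 1) up.
rewrite expect_cst // mulr1 => /(_ (fun=> ler01) (fun _ _ => erefl)).
by under eq_expect do rewrite mulr1.
Qed.

Lemma expect_path_edge Q (D : pred B) x p e : uniq (x :: p) -> e \in path_edges x p ->
  E (fun w => (path (open_pair Q w) x p)%:R * (D (w e))%:R)
  <= pr m D * pr m Q ^+ (size p).-1.
Proof.
move=> up ep.
(* Replacing [Q] by [D] at [e] keeps the events at distinct coordinates. *)
pose phi t (b : B) : R := if t == e then (D b)%:R else (Q b)%:R.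
apply: le_trans (_ : E (fun w => \prod_(t in path_edges x p) phi t (w t)) <= _).
  apply: le_expect => // w; case: (boolP (path _ _ _)) => [pa|_]; last first.
    by rewrite mul0r; apply: prodr_ge0 => t _; rewrite /phi; case: ifP.
  rewrite mul1r (bigD1 e) //= {1}/phi eqxx big1 ?mulr1 // => t /andP[tp te].
  by rewrite /phi (negbTE te) (path_edges_open pa tp).
rewrite (expect_prod m_pmf (h := id) phi) // (bigD1 e) //= {1}/phi eqxx.
rewrite sum_pmf_indic (eq_bigr (fun=> pr m Q)); last first.
  by move=> t /andP[_ /negbTE te]; rewrite /phi te sum_pmf_indic.
rewrite prodr_const (_ : #|_| = (size p).-1) //.
rewrite -(size_path_edges x p) -(card_uniqP (path_edges_uniq up)).
rewrite [in RHS](cardD1 e) ep /=; apply: eq_card => t.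
by rewrite !inE andbC.
Qed.

Lemma expect_connect_le Q (mu : R) x y : n%:R * pr m Q <= mu -> 0 <= mu < 1 ->
  x != y -> E (fun w => (connect (open_pair Q w) x y)%:R) <= (1 - mu)^-1 / n%:R.
Proof.
move=> nq mu01 xy; have q0 := pr_ge0 Q m_pmf; have [mu0 mu1] := andP mu01.
have n0 : 0 < n%:R :> R by rewrite ltr0n; apply/card_gt0P; exists x.
(* A simple path from [x] to [y <> x] with [l] inner vertices has [l + 1]
   edges, which leaves a factor [1 / n]. *)
pose sp l w (p : l.-tuple V) :=
  uniq (x :: rcons p y) && path (open_pair Q w) x (rcons p y).
apply: le_trans (_ : E (fun w => \sum_(l < n) \sum_(p : l.-tuple V) (sp l w p)%:R) <= _).
  apply: le_expect => // w; apply: bool_le_sum => [l|].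
    by apply: sumr_ge0.
  move=> /connect_simple_path[p [ep up lp]].
  case/lastP: p ep up lp => [_ _ /= xy'|p z]; first by rewrite xy' eqxx in xy.
  rewrite last_rcons => ep up zy; rewrite {}zy in ep up.
  have lp : (size p < n)%N.
    by apply: leq_trans (size_simple_path up); rewrite size_rcons ltnS.
  exists (Ordinal lp); apply: (bool_le_sum (b := true)) => // _.
  by exists (in_tuple p); rewrite /sp up ep.
rewrite expect_sum.
apply: le_trans (_ : \sum_(l < n) mu ^+ l / n%:R <= _); last first.
  by rewrite -mulr_suml ler_wpM2r ?invr_ge0 ?ler0n // geometric_sum_le.
apply: ler_sum => l _; rewrite expect_sum.
apply: le_trans (_ : \sum_(p : l.-tuple V) pr m Q ^+ l.+1 <= _).
  apply: ler_sum => p _; rewrite /sp.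
  have [up|_] := boolP (uniq _); last by rewrite expect_cst // exprn_ge0.
  by apply: le_trans (expect_path _ up) _; rewrite size_rcons size_tuple.
rewrite sumr_const card_tuple -[leLHS]mulr_natl natrX.
rewrite ler_pdivlMr //.
have -> : n%:R ^+ l * pr m Q ^+ l.+1 * n%:R = (n%:R * pr m Q) ^+ l.+1.
  by rewrite exprMn !exprS; ring.
apply: le_trans (_ : mu ^+ l.+1 <= _).
  by apply: lerXn2r; rewrite ?nnegrE ?mulr_ge0 ?ler0n.
by rewrite exprS ler_piMl ?exprn_ge0 // ltW.
Qed.

Section Defects.
Context {J : finType} (Q0 D : pred B) (Q : J -> pred B).

Definition shortcut w x p := [exists j, exists a, exists b,
  [&& a \in x :: p, b \in x :: p, a != b &
      connect (open_pair_off (path_edges x p) (Q j) w) a b]].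

(** The two coincidences that a bad pair forces on a simple path joining it. *)
Definition defect w x p :=
  has (fun e => D (w e)) (path_edges x p) || shortcut w x p.

(** A union bound over the place of the coincidence: an edge of the path, or two
    vertices of the path and an index [j]. *)
Lemma expect_defect c x p : uniq (x :: p) -> 0 <= c ->
  (forall j a b, a != b -> E (fun w => (connect (open_pair (Q j) w) a b)%:R) <= c) ->
  E (fun w => (path (open_pair Q0 w) x p && defect w x p)%:R)
  <= (size p)%:R * (pr m D * pr m Q0 ^+ (size p).-1)
     + #|J|%:R * ((size p).+1%:R ^+ 2 * (pr m Q0 ^+ size p * c)).
Proof.
move=> up c0 con; have q0 := pr_ge0 Q0 m_pmf.
pose pa w : R := (path (open_pair Q0 w) x p)%:R.
pose off j a b w : R := (connect (open_pair_off (path_edges x p) (Q j) w) a b)%:R.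
apply: le_trans (_ : E (fun w =>
    \sum_(e in path_edges x p) pa w * (D (w e))%:R +
    \sum_j \sum_(a in x :: p) \sum_(b in x :: p | a != b) pa w * off j a b w) <= _).
  apply: le_expect => // w; rewrite /pa.
  case: (path _ _ _) => /=; last first.
    by rewrite addr_ge0 //; do !(apply: sumr_ge0 => ? _); rewrite mul0r.
  have S1 : 0 <= \sum_(e in path_edges x p) 1 * (D (w e))%:R :> R.
    by apply: sumr_ge0 => e _; rewrite mul1r.
  have S2 j a : 0 <= \sum_(b in x :: p | a != b) 1 * off j a b w.
    by apply: sumr_ge0 => b _; rewrite mul1r.
  have S3 j : 0 <= \sum_(a in x :: p) \sum_(b in x :: p | a != b) 1 * off j a b w.
    by apply: sumr_ge0.
  rewrite /defect; case: hasP => [[e ep De]|_] /=.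
    apply: ler_wpDr; first by apply: sumr_ge0.
    rewrite (bigD1 e) //= De mul1r lerDl.
    by apply: sumr_ge0 => ? _; rewrite mul1r.
  apply: ler_wpDl => //; apply: bool_le_sum => // /existsP[j].
  move=> /existsP[a] /existsP[b] /and4P[ap bp ab abc]; exists j.
  rewrite (bigD1 a) //= (bigD1 b) /=; last by rewrite bp.
  rewrite /off abc mul1r -addrA lerDl addr_ge0 //.
    by apply: sumr_ge0 => ? _; rewrite mul1r.
  by apply: sumr_ge0 => ? _; apply: S2.
rewrite expectD !expect_sum; apply: lerD.
  apply: le_trans (_ : \sum_(e in path_edges x p) pr m D * pr m Q0 ^+ (size p).-1 <= _).
    by apply: ler_sum => e ep; apply: expect_path_edge.
  rewrite sumr_const -[leLHS]mulr_natl ler_wpM2r //.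
    by rewrite mulr_ge0 ?exprn_ge0 ?pr_ge0.
  by rewrite ler_nat -(size_path_edges x p) card_size.
apply: le_trans (_ : \sum_(j : J) (size p).+1%:R ^+ 2 * (pr m Q0 ^+ size p * c) <= _);
  last by rewrite sumr_const [leRHS]mulr_natl.
apply: ler_sum => j _; rewrite expect_sum.
have cp : (#|[in x :: p]| <= (size p).+1)%N by exact: (card_size (x :: p)).
have qc : 0 <= pr m Q0 ^+ size p * c by rewrite mulr_ge0 ?exprn_ge0.
rewrite expr2 -mulrA.
apply: le_trans (_ : \sum_(a in x :: p) (size p).+1%:R * (pr m Q0 ^+ size p * c) <= _); last first.
  rewrite sumr_const -[leLHS]mulr_natl ler_wpM2r ?ler_nat //.
  by rewrite mulr_ge0.
apply: ler_sum => a _; rewrite expect_sum.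
apply: le_trans (_ : \sum_(b in x :: p | a != b) pr m Q0 ^+ size p * c <= _); last first.
  rewrite sumr_const -[leLHS]mulr_natl ler_wpM2r ?ler_nat //.
  apply: leq_trans cp; apply: subset_leq_card.
  by apply/fintype.subsetP => b /andP[].
apply: ler_sum => b /andP[_ ab].
apply: le_trans (expect_path_indep Q0 up _ _) _ => //.
  move=> w w'; congr (_%:R); congr nat_of_bool; apply: eq_connect => s t.
  rewrite /open_pair_off /open_pair ffunE -[_ \in [in _]]/(_ \in path_edges x p).
  by case: (_ \in path_edges x p); rewrite ?andbF.
rewrite ler_wpM2l ?exprn_ge0 //; apply: le_trans (con j a b ab).
apply: le_expect => // w; rewrite ler_nat /off.
by case: (boolP (connect (open_pair_off _ _ _) _ _)) => // /connect_off_sub ->.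
Qed.

(** Summing over simple paths: the factor [n ^ l] for the choice of a path is
    absorbed by [(mu / n) ^ l], the factor [n] for the choice of [u] by the
    probability of the coincidence, and the sum over lengths converges because
    [mu < 1]. *)
Lemma expect_defective_pairs (mu kappa : R) (bad : {ffun {set V} -> B} -> V -> V -> bool) :
  0 <= mu < 1 -> n%:R * pr m Q0 <= mu -> n%:R ^+ 2 * pr m D <= kappa ->
  (forall j, n%:R * pr m (Q j) <= mu) ->
  (forall w u v, bad w u v -> exists p,
     [/\ path (open_pair Q0 w) u p, uniq (u :: p), last u p = v & defect w u p]) ->
  E (fun w => \sum_u \sum_v (bad w u v)%:R)
  <= (kappa + #|J|%:R * (1 - mu)^-1) * (2 / (1 - mu) ^+ 3).
Proof.
move=> mu01 nq nD nQ badP; have [mu0 mu1] := andP mu01.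
have q0 := pr_ge0 Q0 m_pmf; have d0 := pr_ge0 D m_pmf.
have k0 : 0 <= kappa by apply: le_trans nD; rewrite mulr_ge0 ?exprn_ge0.
have mu10 : 0 < (1 - mu)^-1 by rewrite invr_gt0; lra.
pose c : R := (1 - mu)^-1 / n%:R.
have c0 : 0 <= c by rewrite divr_ge0 // ltW.
have con j a b : a != b -> E (fun w => (connect (open_pair (Q j) w) a b)%:R) <= c.
  exact: expect_connect_le.
have nc : n%:R * c <= (1 - mu)^-1.
  rewrite /c; have [->|n0] := eqVneq (n%:R : R) 0; first by rewrite mul0r ltW.
  by rewrite mulrC divfK.
clearbody c.
pose lol w u l (p : l.-tuple V) :=
  uniq (u :: p) && (path (open_pair Q0 w) u p && defect w u p).
apply: le_trans (_ : E (fun w =>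
    \sum_u \sum_(l < n) \sum_(p : l.-tuple V) (lol w u l p)%:R) <= _).
  apply: le_expect => // w; apply: ler_sum => u _.
  apply: le_trans (_ : \sum_v \sum_(l < n) \sum_(p : l.-tuple V)
      (lol w u l p && (last u p == v))%:R <= _).
    apply: ler_sum => v _; apply: bool_le_sum => [l|].
      by apply: sumr_ge0.
    move=> /badP[p [pa up lp df]]; exists (Ordinal (size_simple_path up)).
    apply: (bool_le_sum (b := true)) => // _; exists (in_tuple p).
    by rewrite /lol up pa df lp eqxx.
  rewrite exchange_big; apply: ler_sum => l _.
  rewrite exchange_big; apply: ler_sum => p _ /=.
  rewrite (bigD1 (last u p)) //= eqxx andbT big1 ?addr0 // => v.
  by rewrite eq_sym => /negbTE ->; rewrite andbF.
rewrite expect_sum.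
pose term l : R := l%:R * (pr m D * pr m Q0 ^+ l.-1)
     + #|J|%:R * (l.+1%:R ^+ 2 * (pr m Q0 ^+ l * c)).
have t0 l : 0 <= term l.
  apply: addr_ge0; apply: mulr_ge0; rewrite ?ler0n //.
    by rewrite mulr_ge0 ?exprn_ge0.
  by apply: mulr_ge0; [exact: exprn_ge0 | apply: mulr_ge0 => //; exact: exprn_ge0].
apply: le_trans (_ : \sum_(u : V) \sum_(l < n) n%:R ^+ l * term l <= _).
  apply: ler_sum => u _; rewrite expect_sum; apply: ler_sum => l _.
  rewrite expect_sum; apply: le_trans (_ : \sum_(p : l.-tuple V) term l <= _).
    apply: ler_sum => p _; rewrite /lol.
    have [up|_] := boolP (uniq _); last by rewrite expect_cst.
    by apply: le_trans (expect_defect up c0 con) _; rewrite size_tuple.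
  by rewrite sumr_const card_tuple -[leLHS]mulr_natl natrX.
rewrite sumr_const -[leLHS]mulr_natl mulr_sumr.
have nmu l : n%:R ^+ l * pr m Q0 ^+ l <= mu ^+ l.
  rewrite -exprMn; apply: lerXn2r; rewrite ?nnegrE ?mulr_ge0 //.
apply: le_trans (_ : \sum_(l < n) (l%:R * mu ^+ l.-1 * kappa
    + #|J|%:R * (1 - mu)^-1 * (l.+1%:R ^+ 2 * mu ^+ l)) <= _).
  apply: ler_sum => l _; rewrite /term mulrA -exprS mulrDr; apply: lerD.
    case: (nat_of_ord l) => [|k]; first by rewrite !mul0r mulr0.
    rewrite /= -[leRHS]mulrA mulrCA ler_wpM2l //.
    rewrite [leLHS](_ : _ = n%:R ^+ k * pr m Q0 ^+ k * (n%:R ^+ 2 * pr m D)); last first.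
      by rewrite !exprS; ring.
    by apply: ler_pM; rewrite ?mulr_ge0 ?exprn_ge0.
  rewrite mulrCA -[leRHS]mulrA ler_wpM2l // mulrCA [leRHS]mulrCA ler_wpM2l ?exprn_ge0 //.
  rewrite [leLHS](_ : _ = n%:R * c * (n%:R ^+ l * pr m Q0 ^+ l)); last first.
    by rewrite exprS; ring.
  by apply: ler_pM; rewrite ?mulr_ge0 ?exprn_ge0.
rewrite big_split /= -mulr_suml -mulr_sumr mulrDl.
have quad N := quadratic_geometric_sum_le N mu01.
apply: lerD; last first.
  by apply: ler_wpM2l (quad _); rewrite mulr_ge0 // ltW.
rewrite mulrC; apply: ler_wpM2l => //; apply: le_trans (quad n).
case: n => [|N]; first by rewrite !big_ord0.
rewrite big_ord_recl mul0r add0r big_ord_recr /=; apply: ler_wpDr.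
  by rewrite mulr_ge0 ?exprn_ge0.
apply: ler_sum => l _; rewrite /= ler_wpM2r ?exprn_ge0 // expr2 ler_peMl //.
by rewrite ler1n.
Qed.

End Defects.
End PathCounts.

(** * Edges carrying sets of colors *)

Section Colors.
Context {R : realFieldType} (k : nat).
Implicit Types (c : {set 'I_k}) (p : 'I_k -> R).

Definition color_mass p c : R := \prod_i (if i \in c then p i else 1 - p i).

Definition avoids (i : 'I_k) : pred {set 'I_k} :=
  fun c => [exists j, (j != i) && (j \in c)].

Definition two_other_colors (last : 'I_k) : pred {set 'I_k} :=
  fun c => [exists a, exists b,
    [&& a != b, a != last, b != last, a \in c & b \in c]].

Lemma color_mass_pmf p : (forall i, 0 <= p i <= 1) -> is_pmf (color_mass p).
Proof.
move=> p01; split=> [c|].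
  by apply: prodr_ge0 => i _; have := p01 i; case: ifP => _; lra.
transitivity (\prod_i (p i + (1 - p i))); first by rewrite bigA_distr.
by rewrite big1 // => i _; rewrite addrC subrK.
Qed.

Lemma pr_color_sub p (S : {set 'I_k}) :
  pr (color_mass p) (fun c => S \subset c) = \prod_(i in S) p i.
Proof.
rewrite -sum_pmf_indic [RHS]big_mkcond /=.
rewrite (eq_bigr (fun i => p i + (if i \in S then 0 else 1 - p i))); last first.
  by move=> i _; case: ifP; rewrite ?addr0 // addrC subrK.
rewrite bigA_distr; apply: eq_bigr => c _; rewrite /color_mass.
have [/fintype.subsetP Sc|/subsetPn[i iS ic]] := boolP (S \subset c).
  rewrite mulr1; apply: eq_bigr => i _; case: ifP => // ic.
  by case: ifP => // /Sc; rewrite ic.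
by rewrite mulr0 (bigD1 i) //= (negbTE ic) iS mul0r.
Qed.

Lemma pr_color_in p i : pr (color_mass p) (fun c => i \in c) = p i.
Proof.
have -> : p i = \prod_(j in [set i]%SET) p j by rewrite big_set1.
rewrite -pr_color_sub.
by apply: eq_bigl => c; rewrite finset.sub1set.
Qed.

Lemma pr_avoids_le p i : (forall i, 0 <= p i <= 1) ->
  pr (color_mass p) (avoids i) <= \sum_j p j - p i.
Proof.
move=> p01; apply: le_trans (pr_exists_le _ (color_mass_pmf p01)) _.
rewrite [\sum_j p j](bigD1 i) //= addrAC subrr add0r [leRHS]big_mkcond /=.
by apply: ler_sum => j _; rewrite pr_andl pr_color_in; case: eqP.
Qed.

Lemma pr_two_other_colors_le p last : (forall i, 0 <= p i <= 1) ->
  pr (color_mass p) (two_other_colors last) <= (\sum_j p j) ^+ 2.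
Proof.
move=> p01; have pmf := color_mass_pmf p01.
have p0 i : 0 <= p i by have /andP[] := p01 i.
apply: le_trans (pr_exists_le _ pmf) _.
rewrite expr2 mulr_suml; apply: ler_sum => a _.
apply: le_trans (pr_exists_le _ pmf) _.
rewrite mulr_sumr; apply: ler_sum => b _.
have [->|ab] := eqVneq a b.
  by rewrite /pr big_pred0 ?mulr_ge0 // => c; rewrite eqxx.
apply: le_trans (_ : pr (color_mass p) (fun c => [set a; b]%SET \subset c) <= _).
  apply: le_pr => // c /and5P[_ _ _ ac bc].
  by apply/fintype.subsetP => x /set2P[->|->].
by rewrite pr_color_sub big_setU1 /= ?big_set1 // inE.
Qed.

(** Exchanging the last color between two independent color sets: this exhibits
    the graph of the last color as independent of the other ones. *)
Definition swap_last (last : 'I_k) (b c : {set 'I_k}) : {set 'I_k} :=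
  [set i | if i == last then i \in c else i \in b]%SET.

Lemma swap_lastK last b c :
  swap_last last (swap_last last b c) (swap_last last c b) = b.
Proof. by apply/setP => i; rewrite !inE; case: ifP => ->. Qed.

Lemma color_mass_swap_last p last b c :
  color_mass p (swap_last last b c) * color_mass p (swap_last last c b)
  = color_mass p b * color_mass p c.
Proof.
rewrite /color_mass -!big_split /=; apply: eq_bigr => i _; rewrite !inE.
by case: (i == last); rewrite // mulrC.
Qed.

Section Deterministic.
Context {V : finType} (last i0 : 'I_k) (w : {ffun {set V} -> {set 'I_k}}).
Implicit Types u v : V.

Definition CA_class u : {set V} :=
  [set v | [forall i, connect (open_pair (avoids i) w) u v]]%SET.

Definition bad_pair u v :=
  [forall i, (i != last) ==> connect (open_pair (avoids i) w) u v]
  && ~~ connect (open_pair (fun c => last \in c) w) u v.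

(** Some edge of a simple path avoiding [i0] does not carry the last color. If it
    does not carry two other colors, its only color is some [j], and it is a
    closed edge of the path for the graph avoiding [j]: [bypass] applies. The
    predicate at index [last] is empty, so that all indices give subcritical
    graphs. *)
Lemma bad_pair_defect u v : i0 != last -> bad_pair u v ->
  exists s, [/\ path (open_pair (avoids i0) w) u s, uniq (u :: s), seq.last u s = v &
    defect (two_other_colors last) (fun j c => (j != last) && avoids j c) w u s].
Proof.
move=> i0l /andP[/forallP con ncon].
have := con i0; rewrite i0l /= => /connect_simple_path[s [ps us ls]].
exists s; split=> //; rewrite /defect.
have [|/hasPn no_two] := boolP (has _ _); first by [].
have [/hasP[e es el]|/hasPn all_last] :=
  boolP (has (fun e => last \notin w e) (path_edges u s)); last first.
  case/negP: ncon; rewrite -ls; apply/connectP; exists s => //.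
  by apply: path_open_weaken ps _ => e /all_last /negPn.
have /existsP[j /andP[ji0 je]] := path_edges_open ps es.
have jl : j != last by apply: contraNneq el => <-.
have nj : ~~ avoids j (w e).
  apply: contra (no_two e es) => /existsP[j' /andP[j'j j'e]].
  apply/existsP; exists j; apply/existsP; exists j'.
  have j'l : j' != last by apply: contraNneq el => <-.
  by rewrite eq_sym j'j jl j'l je j'e.
have [q [b [r [sE eE]]]] := path_edges_split es.
have vE : v = seq.last b r by rewrite -ls sE last_cat.
have := con j; rewrite jl /= vE => conj.
rewrite sE in us; rewrite eE in nj.
have [x [y [xs ys xy cxy]]] := bypass us nj conj.
apply/existsP; exists j; apply/existsP; exists x; apply/existsP; exists y.
rewrite sE xs ys xy /=; apply: connect_sub cxy => a a' /andP[aa' nE].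
by apply: connect1; rewrite /open_pair_off nE andbT; move: aa'; rewrite /open_pair jl.
Qed.

Lemma CA_class_le u :
  (#|CA_class u| <= \sum_v bad_pair u v
    + #|cluster (fun c => last \in c) w u :&: cluster (avoids last) w u|)%N.
Proof.
have -> : (\sum_v bad_pair u v = #|[set v | bad_pair u v]|)%N.
  by rewrite -sum1dep_card [RHS]big_mkcond.
apply: leq_trans (leq_card_setU _ _); apply: subset_leq_card.
apply/fintype.subsetP => v; rewrite !inE => /forallP con; rewrite con andbT.
rewrite /bad_pair; case: (connect (open_pair (fun _ => _) w) u v) => //=.
  by rewrite orbT.
by rewrite andbT orbF; apply/forallP => i; rewrite con implybT.
Qed.

End Deterministic.

(** The number [r] is [n ^ (1/8)] up to a factor two, so that the second term
    vanishes as [n] grows while the first one does not depend on [n]. *)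
Lemma CA_class_tail (V : finType) (lambda : 'I_k -> R) (last i0 : 'I_k)
    (mu : R) (r M : nat) :
  let n : R := #|V|%:R in
  let Lambda := \sum_i lambda i in
  let p i := lambda i / n in
  (forall i, 0 <= lambda i) -> (forall i, p i <= 1) -> i0 != last ->
  Lambda - lambda last <= 1 ->
  (forall i, i != last -> Lambda - lambda i <= mu) -> mu < 1 ->
  (2 <= r)%N -> 2 <= (1 - mu) ^+ 2 / 8 * r%:R :> R ->
  (r ^ 8 <= #|V| <= 256 * r ^ 8)%N -> (5 < M)%N ->
  @expect R _ {set V} (color_mass p)
    (fun w => [exists u, (M <= #|CA_class w u|)%N]%:R)
  <= (Lambda ^+ 2 + k%:R * (1 - mu)^-1) * (2 / (1 - mu) ^+ 3) / (M - 5)%N%:R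
     + (1024 + 16384 / ((1 - mu) ^+ 2 / 8) ^+ 5) / r%:R.
Proof.
move=> n Lambda p l0 p1 i0l crit sub mu1 r2 er r8 M5.
have n0N : (0 < #|V|)%N.
  by case/andP: r8 => r8 _; apply: leq_trans r8; rewrite expn_gt0 (leq_trans _ r2).
have n0 : 0 < n by rewrite ltr0n.
have p01 i : 0 <= p i <= 1 by rewrite p1 andbT divr_ge0 // ltW.
have pmf := color_mass_pmf p01.
have sum_p : n * (\sum_j p j) = Lambda.
  by rewrite -mulr_suml mulrC divfK // lt0r_neq0.
have np i : n * p i = lambda i by rewrite mulrC divfK // lt0r_neq0.
have navoid i : n * pr (color_mass p) (avoids i) <= Lambda - lambda i.
  rewrite -sum_p -np -mulrBr; apply: ler_wpM2l; first exact: ltW.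
  exact: pr_avoids_le.
have nlast : n * pr (color_mass p) (fun c => last \in c) <= mu.
  rewrite pr_color_in np; apply: le_trans (sub i0 i0l).
  rewrite /Lambda (bigD1 i0) //= addrAC subrr add0r (bigD1 last) 1?eq_sym //= lerDl.
  by apply: sumr_ge0.
have mu0 : 0 <= mu.
  by apply: le_trans nlast; rewrite mulr_ge0 ?pr_ge0 // ltW.
have mu01 : 0 <= mu < 1 by rewrite mu0.
pose small6 w := [exists u : V,
  (6 <= #|cluster (fun c => last \in c) w u :&: cluster (avoids last) w u|)%N].
pose nbad w : R := \sum_u \sum_v (bad_pair (V := V) last w u v)%:R.
apply: le_trans (_ : expect (color_mass p)
   (fun w => (M - 5 <= \sum_u \sum_v bad_pair (V := V) last w u v)%N%:R + (small6 w)%:R) <= _).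
  apply: le_expect => // w; case: existsP => [[u Mu]|_] //; last by rewrite addr_ge0.
  have [s6|/existsPn big6] := boolP (small6 w).
    by rewrite lerDr.
  rewrite addr0 (_ : (_ <= _)%N) // leq_subLR.
  apply: leq_trans Mu _; apply: leq_trans (CA_class_le last w u) _.
  rewrite addnC; apply: leq_add; first by have := big6 u; rewrite -ltnNge.
  by rewrite [leqRHS](bigD1 u) //= leq_addr.
rewrite expectD; apply: lerD; last first.
  apply: (joint_clusters_small pmf (theta := swap_last last)) => //.
  - exact: color_mass_swap_last.
  - exact: swap_lastK.
  - move=> b c; apply: eq_existsb => i; rewrite inE.
    by case: (eqVneq i last).
  - by move=> b c; rewrite inE eqxx.
  - by apply: le_trans crit.
have M50 : 0 < (M - 5)%N%:R :> R by rewrite ltr0n subn_gt0.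
apply: le_trans (expect_markov pmf (f := nbad) M50 _ _) _.
- by move=> w; apply: sumr_ge0 => u _; apply: sumr_ge0.
- move=> w; rewrite -(ler_nat R) => /le_trans; apply.
  by rewrite natr_sum; apply: ler_sum => u _; rewrite natr_sum.
rewrite ler_wpM2r ?invr_ge0 ?ler0n // -[k in k%:R]card_ord.
apply: (@expect_defective_pairs R V _ _ pmf _ (avoids i0) (two_other_colors last)
   (fun j c => (j != last) && avoids j c) mu) => //.
- by apply: le_trans (navoid i0) _; apply: sub.
- rewrite -sum_p exprMn; apply: ler_wpM2l; first by rewrite exprn_ge0 // ltW.
  exact: pr_two_other_colors_le.
- move=> j; rewrite pr_andl; case: (boolP (j != last)) => [jl|_].
    by apply: le_trans (navoid j) _; apply: sub.
  by rewrite mulr0.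
- by move=> w u v; apply: bad_pair_defect.
Qed.

End Colors.

(** * From the colored random graph to the field of colors *)

Section GraphsFromField.
Context {R : realType} {n k : nat}.
Implicit Types (w : {ffun {set 'I_n} -> {set 'I_k}}).

Definition field_graphs w : {ffun 'I_k -> graph n} :=
  [ffun i => [set e : edge n | i \in w (val e)]%SET].

Lemma CA_component_field w u : CA_component (field_graphs w) u = CA_class w u.
Proof.
apply/setP => v; rewrite !inE; apply: eq_forallb => i.
apply: eq_connect => x y; apply/existsP/andP => [[e /andP[eA /eqP exy]]|].
  have xy : x != y.
    by have := valP e; rewrite exy cards2; case: (x != y).
  split=> //; move: eA => /finset.bigcupP[j ji]; rewrite ffunE inE exy => jw.
  by apply/existsP; exists j; rewrite ji.
move=> [xy /existsP[j /andP[ji jw]]].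
have c2 : #|[set x; y]%SET| == 2%N by rewrite cards2 xy.
exists (Sub [set x; y]%SET c2); rewrite SubK eqxx andbT.
by apply/finset.bigcupP; exists j; rewrite // ffunE inE SubK.
Qed.

Lemma max_CA_component_field w (M : nat) : (0 < M)%N ->
  (M <= max_CA_component (field_graphs w))%N =
  [exists u, (M <= #|CA_class w u|)%N].
Proof.
case: M => // M _; apply/idP/idP => [|/existsP[u Mu]]; last first.
  by apply: leq_trans Mu _; rewrite -CA_component_field; apply: leq_bigmax.
apply: contraLR => /existsPn small; rewrite -ltnNge ltnS.
by apply/bigmax_leqP => u _; have := small u; rewrite -ltnNge CA_component_field.
Qed.

(** The graphs only see the coordinates of the field at two-element sets, where
    the colors of an edge are independent: both sides weigh a family of graphs
    by a product over edges and colors. *)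
Lemma expect_field_graphs (p : 'I_k -> R) (D : {ffun 'I_k -> graph n} -> bool) :
  (forall i, 0 <= p i <= 1) ->
  expect (color_mass p) (fun w => (D (field_graphs w))%:R)
  = \sum_(g | D g) \prod_i gnp_mass (p i) (g i).
Proof.
move=> p01; have pmf := color_mass_pmf p01.
transitivity (expect (color_mass p) (fun w : {ffun {set 'I_n} -> {set 'I_k}} =>
    \sum_(g | D g) (field_graphs w == g)%:R)).
  apply: eq_expect => w; case: (boolP (D (field_graphs w))) => Dw.
    rewrite (bigD1 (field_graphs w)) //= eqxx big1 ?addr0 // => g /andP[_].
    by rewrite eq_sym => /negbTE ->.
  rewrite big1 // => g Dg; case: eqP => // wg.
  by rewrite -wg (negbTE Dw) in Dg.
rewrite expect_sum; apply: eq_bigr => g _.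
pose colors (e : edge n) : {set 'I_k} := [set i | e \in g i]%SET.
transitivity (expect (color_mass p) (fun w : {ffun {set 'I_n} -> {set 'I_k}} =>
    \prod_(e in @predT (edge n)) (w (val e) == colors e)%:R)).
  apply: eq_expect => w; case: eqP => [wg|neq].
    rewrite big1 // => e _; case: eqP => // -[]; apply/setP => i.
    by rewrite !inE -wg ffunE inE.
  have [/forallP all_eq|/forallPn[e ne]] :=
    boolP [forall e : edge n, w (val e) == colors e]; last first.
    by rewrite (bigD1 e) //= (negbTE ne) mul0r.
  case: neq; apply/ffunP => i; apply/setP => e; rewrite ffunE inE.
  by rewrite (eqP (all_eq e)) inE.
rewrite (expect_prod pmf (fun e c => (c == colors e)%:R)); last first.
  by move=> e e' _ _; apply: val_inj.
rewrite exchange_big /=; apply: eq_bigr => e _.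
rewrite sum_pmf_indic /pr (big_pred1 (colors e)) //.
by apply: eq_bigr => i _; rewrite inE.
Qed.

End GraphsFromField.

Section Transfer.
Context {R : realType} {d : measure_display} {T : measurableType d}.
Context (P : probability T R) {n k : nat}.
Local Open Scope classical_set_scope.

Lemma measure_bigsetU_le (I : Type) (s : seq I) (Q : pred I) (F : I -> set T) :
  (forall i, measurable (F i)) ->
  (P (\big[setU/set0]_(i <- s | Q i) F i) <= \sum_(i <- s | Q i) P (F i))%E.
Proof.
move=> mF; elim: s => [|i s IH]; first by rewrite !big_nil measure0.
rewrite !big_cons; case: (Q i) => //.
apply: le_trans (measureU2 _ _ _) _; rewrite ?leeD2l //.
exact: bigsetU_measurable.
Qed.

(** The law of a random family of graphs is determined by the events that fix
    all the graphs, of which there are finitely many. *)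
Lemma probability_graphs_le (lambda : 'I_k -> R) (X : 'I_k -> T -> graph n)
    (D : {ffun 'I_k -> graph n} -> bool) :
  colored_random_graph P lambda X ->
  (forall i, 0 <= lambda i / n%:R <= 1) ->
  (P [set w | D [ffun i => X i w]]
  <= (expect (color_mass (fun i => lambda i / n%:R))
       (fun w => (D (@field_graphs n k w))%:R))%:E)%E.
Proof.
move=> [Gnp ind] p01; rewrite expect_field_graphs //.
pose S (g : {ffun 'I_k -> graph n}) := [set w | forall i, [set g i] (X i w)].
have mS g : measurable (S g).
  rewrite (_ : S g = \bigcap_(i in [set: 'I_k]) (X i @^-1` [set g i])); last first.
    by apply/seteqP; split=> w Sw i; [move=> _|]; apply: Sw.
  by apply: fin_bigcap_measurable => // i _; have [+ _] := Gnp i; apply.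
have -> : [set w | D [ffun i => X i w]] = \big[setU/set0]_(g | D g) S g.
  rewrite -bigcup_seq_cond; apply/seteqP; split=> w /=.
    move=> Dw; exists [ffun i => X i w]; first by rewrite /= mem_index_enum.
    by move=> i; rewrite /= ffunE.
  move=> [g /= /andP[_ Dg] Sg]; rewrite (_ : [ffun i => X i w] = g) //.
  by apply/ffunP => i; rewrite ffunE; apply: Sg.
apply: le_trans (measure_bigsetU_le _ _ mS) _.
rewrite -sumEFin; apply: lee_sum => g _.
rewrite (ind (fun i => [set g i]) : P (S g) = _) -prodEFin.
by under eq_bigr do rewrite (proj2 (Gnp _)).
Qed.

End Transfer.

(** * Uniform tightness *)

Section UniformTail.
Context {R : realType} {k : nat} (lambda : 'I_k -> R) (penult last : 'I_k).
Hypotheses (k_ge2 : (2 <= k)%N) (lambda_gt0 : forall i, 0 < lambda i)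
  (lambda_noninc : forall i j : 'I_k, (i <= j)%N -> lambda j <= lambda i)
  (penultE : penult = k.-2 :> nat) (lastE : last = k.-1 :> nat)
  (critical : lambda_star lambda last = 1)
  (subcritical : lambda_star lambda penult < 1).

Lemma penult_neq_last : penult != last.
Proof. by rewrite -val_eqE /= penultE lastE; case: k k_ge2 => [|[|j]] //=; rewrite neq_ltn ltnSn. Qed.

Lemma lambda_star_le_penult i : i != last ->
  lambda_star lambda i <= lambda_star lambda penult.
Proof.
rewrite -val_eqE /= lastE /lambda_star => il.
rewrite lerD2l lerN2; apply: lambda_noninc; rewrite penultE.
have le_pred2 j : (j < k)%N -> j != k.-1 -> (j <= k.-2)%N.
  case: (k) k_ge2 => [|[|k']] //= _; rewrite ltnS leq_eqVlt => /orP[->//|].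
  by rewrite ltnS.
exact: le_pred2 (ltn_ord i) il.
Qed.

Lemma lambda_le1 i : lambda i <= 1.
Proof.
have le_other j : j != last -> lambda j <= 1.
  move=> jl; rewrite -critical /lambda_star (bigD1 last) //= addrAC subrr add0r.
  rewrite (bigD1 j) //= lerDl; apply: sumr_ge0 => a _; exact: ltW.
have [->|/le_other //] := eqVneq i last.
apply: le_trans (le_other _ penult_neq_last).
by apply: lambda_noninc; rewrite penultE lastE leq_pred.
Qed.

Lemma intensity01 n i : (0 < n)%N -> 0 <= lambda i / n%:R <= 1.
Proof.
move=> n0; rewrite divr_ge0 ?ler0n ?(ltW (lambda_gt0 i)) //=.
rewrite ler_pdivrMr ?ltr0n // mul1r; apply: le_trans (lambda_le1 i) _.
by rewrite ler1n.
Qed.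

Lemma max_CA_component_le n (g : {ffun 'I_k -> graph n}) :
  (max_CA_component g <= n)%N.
Proof.
apply/bigmax_leqP => u _; apply: leq_trans (max_card _) _.
by rewrite card_ord.
Qed.

(** For [n] below a threshold depending on [e] the components have at most [n]
    vertices; above it [CA_class_tail] applies with [r] a power of two. *)
Lemma max_CA_component_tail (e : R) : 0 < e -> exists M : nat,
  forall n, (0 < n)%N ->
  expect (color_mass (fun i => lambda i / n%:R)) (fun w =>
    ((M <= max_CA_component (@field_graphs n k w))%N)%:R) <= e.
Proof.
move=> e0; have half (x y : R) : 2 * x <= y * e -> x <= e / 2 * y by lra.
have mu_lt1 := subcritical.
set mu := lambda_star lambda penult in mu_lt1.
have mu0 : 0 <= mu.
  rewrite /mu /lambda_star (bigD1 penult) //= addrAC subrr add0r.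
  by apply: sumr_ge0 => a _; exact: ltW.
pose C0 : R := ((\sum_i lambda i) ^+ 2 + k%:R * (1 - mu)^-1) * (2 / (1 - mu) ^+ 3).
pose eps : R := (1 - mu) ^+ 2 / 8.
pose C1 : R := 1024 + 16384 / eps ^+ 5.
have mu1 : 0 < 1 - mu by lra.
have eps0 : 0 < eps by rewrite divr_gt0 ?exprn_gt0.
have C00 : 0 <= C0.
  rewrite mulr_ge0 ?divr_ge0 ?exprn_ge0 ?(ltW mu1) //.
  by rewrite addr_ge0 ?sqr_ge0 // mulr_ge0 // invr_ge0 ltW.
have C10 : 0 <= C1.
  apply: addr_ge0; first exact: ler0n.
  by apply: divr_ge0; [exact: ler0n | exact/exprn_ge0/ltW].
have bnd (x : R) : 0 <= x -> exists N : nat, x <= N%:R.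
  by move=> x0; exists (Num.bound x); apply/ltW/archi_boundP.
have [N0 hN0] := bnd (2 * C0 / e) (divr_ge0 (mulr_ge0 (ler0n _ _) C00) (ltW e0)).
have [N1 hN1] := bnd (2 * C1 / e) (divr_ge0 (mulr_ge0 (ler0n _ _) C10) (ltW e0)).
have [N2 hN2] := bnd (2 / eps) (divr_ge0 (ler0n _ _) (ltW eps0)).
(* Since [256 = 2 ^ 8], the number [2 ^ trunc_log 256 n] is the eighth root of
   [n] up to a factor two, and it is at least [a] once [n] is at least
   [256 ^ a]. *)
pose a := (N1 + N2).+1.
exists (256 ^ a + N0 + 6)%N => n n0.
set M := (_ + 6)%N.
have [small|big] := ltnP n (256 ^ a).
  rewrite (@eq_expect _ _ _ _ _ (fun=> 0)) ?expect_cst ?ltW //.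
    exact: (color_mass_pmf (fun i => intensity01 i n0)).
  move=> w; rewrite leqNgt (_ : (_ < _)%N) //.
  apply: leq_ltn_trans (max_CA_component_le _) _.
  by apply: leq_trans small _; rewrite /M -addnA leq_addr.
pose r := (2 ^ trunc_log 256 n)%N.
have r8 : (r ^ 8 = 256 ^ trunc_log 256 n)%N.
  by rewrite /r -expnM mulnC expnM.
have ar : (a <= r)%N.
  apply: leq_trans (ltnW (ltn_expl a (isT : 1 < 2)%N)) _.
  by rewrite leq_exp2l // trunc_log_max.
have N1r : N1%:R <= r%:R :> R.
  by rewrite ler_nat; apply: leq_trans ar; rewrite /a -addSn ltnW // leq_addr.
have N2r : N2%:R <= r%:R :> R.
  by rewrite ler_nat; apply: leq_trans ar; rewrite /a ltnW // ltnS leq_addl.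
have r0 : 0 < r%:R :> R by rewrite ltr0n expn_gt0.
rewrite (@eq_expect _ _ _ _ _
    (fun w => [exists u, (M <= #|CA_class w u|)%N]%:R));
  last by move=> w; rewrite max_CA_component_field ?addn_gt0 ?orbT.
have := @CA_class_tail R k 'I_n lambda last penult mu r M.
rewrite card_ord /= -/eps -/C1 -/C0 => /(_ _ _ penult_neq_last _ _ _ _ _ _ _) h.
apply: le_trans (h _ _ _ _ _ _ _ _ _) _.
- by move=> i; exact: ltW.
- by move=> i; case/andP: (intensity01 i n0).
- by rewrite -critical.
- exact: lambda_star_le_penult.
- by [].
- by rewrite /r -[X in (X <= _)%N](expn1 2) leq_exp2l // trunc_log_gt0 /=;
    apply: leq_trans big; rewrite /a expnS leq_pmulr // expn_gt0.
- move: (le_trans hN2 N2r); rewrite ler_pdivrMr // mulrC; exact.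
- rewrite r8 trunc_logP //= -expnS ltnW // trunc_log_ltn //.
- by rewrite /M addnS ltnS leq_addl.
rewrite (splitr e).
apply: lerD.
  rewrite ler_pdivrMr ?ltr0n ?subn_gt0; last by rewrite /M addnS ltnS leq_addl.
  have : N0%:R <= (M - 5)%N%:R :> R.
    by rewrite ler_nat /M -addnBA // -addnA addnCA leq_addr.
  by move=> h'; have := le_trans hN0 h'; rewrite ler_pdivrMr // => /half.
rewrite ler_pdivrMr //; by have := le_trans hN1 N1r; rewrite ler_pdivrMr // => /half.
Qed.

End UniformTail.

Local Open Scope classical_set_scope.
Local Open Scope ring_scope.

Theorem proposition1p3 (R : realType) (k : nat) (k_ge2 : (2 <= k)%N)
    (lambda : 'I_k -> R)
    (lambda_gt0 : forall i : 'I_k, 0 < lambda i)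
    (lambda_noninc : forall i j : 'I_k, (i <= j)%N -> lambda j <= lambda i)
    (penult last : 'I_k)
    (penultE : penult = k.-2 :> nat) (lastE : last = k.-1 :> nat)
    (d : nat -> measure_display)
    (Omega : forall n : nat, measurableType (d n))
    (P : forall n : nat, probability (Omega n) R)
    (G : forall n : nat, 'I_k -> Omega n -> graph n)
    (G_random : forall n : nat, (1 <= n)%N ->
       colored_random_graph (P n) lambda (G n))
    (critical : lambda_star lambda last = 1)
    (subcritical : lambda_star lambda penult < 1) :
  ereal_sup [set P n [set w : Omega n |
                      M <= (max_CA_component (fun i => G n i w))%:R]
            | n in [set n : nat | (1 <= n)%N]]
    @[M --> (+oo : set_system R)] --> (0 : \bar R)%E.
Proof.
pose sup_tail (M : R) := ereal_sup [set P n [set w : Omega n |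
    M <= (max_CA_component (fun i => G n i w))%:R] | n in [set n | (1 <= n)%N]].
have sup_ge0 M : (0 <= sup_tail M)%E.
  by apply: le_ereal_sup_tmp; exists (P 1%N [set w |
    M <= (max_CA_component (fun i => G 1%N i w))%:R]) => //; exists 1%N.
have sup_le (e : R) : 0 < e -> \forall M \near +oo, (sup_tail M <= e%:E)%E.
  move=> e0.
  have [M0 tail] := max_CA_component_tail k_ge2 lambda_gt0 lambda_noninc
    penultE lastE critical subcritical e0.
  near=> M; apply: ge_ereal_sup => _ [n /= n0 <-].
  have p01 i := intensity01 k_ge2 lambda_gt0 lambda_noninc penultE lastE
    critical i n0.
  pose D (g : {ffun 'I_k -> graph n}) := M <= (max_CA_component g)%:R.
  have -> : [set w : Omega n | M <= (max_CA_component (fun i => G n i w))%:R]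
      = [set w | D [ffun i => G n i w]].
    have famE w : (fun i => G n i w) = [ffun i => G n i w].
      by apply/funext => i; rewrite ffunE.
    by apply/seteqP; split=> w; rewrite /= /D -famE.
  apply: le_trans (probability_graphs_le D (G_random n n0) p01) _.
  rewrite lee_fin; apply: le_trans (tail n n0); apply: le_expect.
    exact: color_mass_pmf.
  move=> w; rewrite ler_nat /D; case: (boolP (M <= _)) => // MD.
  rewrite (_ : (M0 <= _)%N) // -(ler_nat R); apply: le_trans MD.
  by near: M; apply: nbhs_pinfty_ge; rewrite num_real.
have sup_fin : \forall M \near +oo, sup_tail M \is a fin_num.
  near=> M; rewrite ge0_fin_numE //; apply: (@le_lt_trans _ _ 1%E).
    by near: M; apply: sup_le.
  exact: ltry.
apply/fine_cvgP; split => //; apply/cvgrPdist_le => e e0.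
near=> M; rewrite /= -/(sup_tail M).
have leM : (sup_tail M <= e%:E)%E by near: M; apply: sup_le.
have finM : sup_tail M \is a fin_num by near: M.
by rewrite sub0r normrN ger0_norm ?fine_ge0 // -lee_fin fineK.
Unshelve. all: by end_near.
Qed.
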